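(* Every satisfiable $\mathbf F_{q/1},\mathbf G_1,\vee$-formula $\phi$ has a model of height at most $|\phi|^2$.
   Context: Fix a finite set $\mathcal A$ of atomic propositions. A Markov chain is $M=(S,P,s_0,L)$ with $S$ countable, $P:S\times S\to[0,1]$, $\sum_tP(s,t)=1$ for all $s$, initial state $s_0$, labeling $L:S\to2^{\mathcal A}$. $\mathbb P_{M(s)}$ is the standard probability measure on runs from $s$; $\pi[i]$ is the $i$-th state of run $\pi$. PCTL$(\mathbf F,\mathbf G)$ formulae: $a,\neg a$ ($a\in\mathcal A$), $\wedge,\vee$, $\mathbf F_{\rhd q}\varphi$, $\mathbf G_{\rhd q}\varphi$ ($\rhd\in\{\ge,>\}$, $q\in[0,1]\cap\mathbb Q$), with $M,s\models\mathbf F_{\rhd q}\varphi$ iff $\mathbb P_{M(s)}(\{\pi\mid\exists i: M,\pi[i]\models\varphi\})\rhd q$ and $M,s\models\mathbf G_{\rhd q}\varphi$ iff $\mathbb P_{M(s)}(\{\pi\mid\forall i:M,\pi[i]\models\varphi\})\rhd q$; literals via $L$, Boolean connectives as usual. $=1$ means $\ge1$. $M$ is a model of $\phi$ if $M,s_0\models\phi$; $\phi$ is satisfiable if it has a (countable) model. $|\phi|$ is the length of $\phi$. $\mathbf F_{q/1},\mathbf G_1,\vee$-formulae are given by $\Phi::=a\mid\neg a\mid\Phi\wedge\Phi\mid\Phi\vee\Phi\mid\mathbf F_{\rhd q}\Phi\mid\mathbf G_{=1}\Psi$ and $\Psi::=a\mid\neg a\mid\Psi\wedge\Psi\mid\Psi\vee\Psi\mid\mathbf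 F_{=1}\Psi\mid\mathbf G_{=1}\Psi$. A Markov chain has height $h$ if its transition graph (edges $s\to t$ with $P(s,t)>0$) is a tree rooted at $s_0$ of height $h$ together with additional back edges (edges from a node to one of its ancestors or to itself). *)

(* Defs.v *)
From HB Require Import structures.
From mathcomp Require Import all_boot all_order all_algebra.
From mathcomp Require Import all_classical all_reals all_analysis.
From mathcomp Require Import measurable_realfun.

Set Implicit Arguments.
Unset Strict Implicit.
Unset Printing Implicit Defensive.

Import Order.TTheory GRing.Theory Num.Theory.
Import numFieldNormedType.Exports.

Local Open Scope classical_set_scope.
Local Open Scope ring_scope.

Record markov_chain (R : realType) (A : finType) := MarkovChain {
  state : countType;
  trans : state -> state -> R;
  trans_ge0 : forall s t, 0 <= trans s t;
  trans_le1 : forall s t, trans s t <= 1;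
  trans_sum1 : forall s, (\esum_(t in [set: state]) (trans s t)%:E = 1)%E;
  init : state;
  label : state -> {set A} }.

(* All state sequences; those using a transition of probability 0 form a null
   set of the run measure. *)
Definition run (R : realType) (A : finType) (M : markov_chain R A) :=
  nat -> state M.

HB.instance Definition _ (R : realType) (A : finType) (M : markov_chain R A) :=
  gen_eqMixin (run M).
HB.instance Definition _ (R : realType) (A : finType) (M : markov_chain R A) :=
  gen_choiceMixin (run M).
HB.instance Definition _ (R : realType) (A : finType) (M : markov_chain R A) :=
  isPointed.Build (run M) (fun=> init M).

Definition cylinder (R : realType) (A : finType) (M : markov_chain R A)
    (w : seq (state M)) : set (run M) :=
  [set pi | mkseq pi (size w) = w].

Definition cylinders (R : realType) (A : finType) (M : markov_chain R A) :
  set (set (run M)) := range (@cylinder R A M).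

Definition run_space (R : realType) (A : finType) (M : markov_chain R A) :=
  g_sigma_algebraType (@cylinders R A M).

HB.instance Definition _ (R : realType) (A : finType) (M : markov_chain R A) :=
  Measurable.copy (run_space M) (g_sigma_algebraType (@cylinders R A M)).

Fixpoint path_prob (R : realType) (A : finType) (M : markov_chain R A)
    (s : state M) (w : seq (state M)) : R :=
  if w is t :: w' then trans s t * path_prob t w' else 1.

Definition is_run_measure (R : realType) (A : finType) (M : markov_chain R A)
    (s : state M) (mu : probability (run_space M) R) : Prop :=
  forall w, mu (cylinder (s :: w)) = (path_prob s w)%:E.

(* Existence of the run measure: the image of Lebesgue measure on [0, 1[ by the
   map that reads off u the successive states, state t being selected from s
   when u lies in [cumul s t, cumul s t + trans s t[, which is then rescaled
   to [0, 1[. *)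
Section run_measure_construction.
Context (R : realType) (A : finType) (M : markov_chain R A).
Implicit Types (s t : state M) (u : R) (w : seq (state M)).

Let p s (k : nat) : R := if pickle_inv k is Some t then trans s t else 0.

Let p_ge0 s k : 0 <= p s k.
Proof. by rewrite /p; case: pickle_inv => // t; exact: trans_ge0. Qed.

Let p_pickle s t : p s (pickle t) = trans s t.
Proof. by rewrite /p pickleK_inv. Qed.

Let psum s n : R := \sum_(k < n) p s k.

Let psumS s n : psum s n.+1 = psum s n + p s n.
Proof. by rewrite /psum big_ord_recr. Qed.

Let psum_ge0 s n : 0 <= psum s n.
Proof. by apply: sumr_ge0 => k _. Qed.

Let psum_mono s m n : (m <= n)%N -> psum s m <= psum s n.
Proof.
move=> /subnKC <-; elim: (n - m)%N => [|k IH]; first by rewrite addn0.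
by rewrite addnS psumS (le_trans IH)// lerDl.
Qed.

Let p_series s : (\sum_(k <oo) (p s k)%:E = 1)%E.
Proof.
rewrite nneseries_esumT; last by move=> n; rewrite lee_fin.
rewrite -(trans_sum1 s).
have -> : (\esum_(t in [set: state M]) (trans s t)%:E =
           \esum_(t in [set: state M]) (p s (pickle t))%:E)%E.
  by apply: eq_esum => t _; rewrite p_pickle.
rewrite -(@esum_image R (state M) nat setT (@pickle (state M)) (fun k => (p s k)%:E)); last first.
  by move=> x y _ _; exact: (pcan_inj pickleK).
rewrite [RHS]esum_mkcond; apply: eq_esum => k _.
case: ifPn => //; rewrite notin_setE => nk.
rewrite /p; case E : (pickle_inv k) => [t|//].
exfalso; apply: nk; exists t => //.
by have := @pickle_invK (state M) k; rewrite E.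
Qed.

Let psum_cvg s : (fun n => (psum s n)%:E) @ \oo --> (1 : \bar R)%E.
Proof.
rewrite -(p_series s).
have -> : (fun n => (psum s n)%:E) =
    (fun n => (\sum_(0 <= k < n) (p s k)%:E)%E).
  by apply/funext => n; rewrite big_mkord /psum sumEFin.
by apply: is_cvg_nneseries => n _ _; rewrite lee_fin.
Qed.

Let psum_le1 s n : psum s n <= 1.
Proof.
rewrite -lee_fin -(p_series s).
have -> : (psum s n)%:E = (\sum_(0 <= k < n) (p s k)%:E)%E.
  by rewrite big_mkord /psum sumEFin.
by apply: nneseries_lim_ge => k _; rewrite lee_fin.
Qed.

Let psum_gt s u : u < 1 -> exists n, u < psum s n.
Proof.
move=> u1; apply: contrapT => /forallNP H.
have : ((1 : \bar R) <= u%:E)%E.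
  rewrite -(cvg_lim _ (@psum_cvg s))//; apply: lime_le.
    by apply/cvg_ex; exists 1%E; exact: psum_cvg.
  by apply: nearW => n; rewrite lee_fin leNgt; apply/negP/H.
by rewrite lee_fin leNgt u1.
Qed.

Let cumul s t : R := psum s (pickle t).

Let selects s u t := cumul s t <= u < cumul s t + trans s t.

Let selects_ex s u : 0 <= u < 1 -> exists t, selects s u t.
Proof.
case/andP=> u0 u1; have ex := psum_gt s u1.
case: (ex_minnP ex) => -[|n] un nmin.
  by move: un; rewrite /psum big_ord0 ltNge u0.
have nu : psum s n <= u.
  by rewrite leNgt; apply/negP => /nmin; rewrite ltnn.
move: un; rewrite psumS => un.
have : p s n != 0.
  by apply/eqP => p0; move: un; rewrite p0 addr0 ltNge nu.
rewrite /p; case E : (pickle_inv n) => [t|]; last by rewrite eqxx.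
have tn : pickle t = n by have := @pickle_invK (state M) n; rewrite E.
by move=> _; exists t; rewrite /selects /cumul -p_pickle tn nu.
Qed.

Let selects_inj s u t t' : selects s u t -> selects s u t' -> t = t'.
Proof.
wlog tt' : t t' / (pickle t <= pickle t')%N => [H st st'|].
  by case: (leqP (pickle t) (pickle t')) => [|/ltnW] h;
    [|apply/esym]; apply: H.
case/andP=> _ h1 /andP[h2 _]; apply: (pcan_inj pickleK).
move: tt'; rewrite leq_eqVlt => /orP[/eqP//|tt'].
have := psum_mono s tt'; rewrite psumS p_pickle => h3.
by have := lt_le_trans h1 (le_trans h3 h2); rewrite ltxx.
Qed.

Let next s u : state M := xget s [set t | selects s u t].

Let nextP s u t : 0 <= u < 1 -> next s u = t <-> selects s u t.
Proof.
move=> /(selects_ex s) [t0 st0].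
have nx : selects s u (next s u).
  by apply: (@xgetPex _ s [set t | selects s u t]); exists t0.
by split=> [<-//|st]; exact: selects_inj nx st.
Qed.

Let rescale s u : R := (u - cumul s (next s u)) / trans s (next s u).

Let step (x : state M * R) : state M * R := (next x.1 x.2, rescale x.1 x.2).

Let read s u : run M := fun n => (iter n step (s, u)).1.

Let readS s u : mkseq (read s u) =1
  (fun n => if n is m.+1 then s :: mkseq (read (next s u) (rescale s u)) m
            else [::]).
Proof.
case=> // n; rewrite /mkseq /= -[in LHS]addn1 addnC iotaDl -map_comp.
congr (_ :: _); apply: eq_map => k /=.
by rewrite /read add1n iterSr.
Qed.

Let unit_itv u := 0 <= u < 1.

Let rescale_itv s t u (st : selects s u t) a b :
  0 < trans s t ->
  (a <= (u - cumul s t) / trans s t < b) =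
  (cumul s t + trans s t * a <= u < cumul s t + trans s t * b).
Proof.
move=> t0; rewrite ler_pdivlMr// ltr_pdivrMr//.
by rewrite lerBrDl ltrBlDl ![trans s t * _]mulrC.
Qed.

Let read_cylinder s w : exists a b : R, [/\ 0 <= a, a <= b, b <= 1,
  b - a = path_prob s w &
  forall u, unit_itv u -> (cylinder (s :: w) (read s u) <-> a <= u < b)].
Proof.
elim: w s => [|t w IH] s.
  exists 0, 1; split; rewrite ?ler01 ?lexx ?subr0//.
have [a [b [a0 ab b1 abE abP]]] := IH t.
have T0 := trans_ge0 s t.
have cT1 : cumul s t + trans s t <= 1.
  by rewrite /cumul -p_pickle -psumS psum_le1.
exists (cumul s t + trans s t * a), (cumul s t + trans s t * b); split.
- by rewrite addr_ge0 ?mulr_ge0// psum_ge0.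
- by rewrite lerD2l ler_wpM2l.
- by rewrite (le_trans _ cT1)// lerD2l ler_piMr.
- by rewrite /= -abE mulrBr opprD addrACA subrr add0r.
move=> u u01; rewrite /cylinder /= readS.
split.
- move=> [E].
  have nt : next s u = t by case: E.
  have /andP[h1 h2] : selects s u t by apply/nextP.
  have tpos : 0 < trans s t by rewrite -(ltrD2l (cumul s t)) addr0 (le_lt_trans h1).
  rewrite -rescale_itv//; last by rewrite /selects h1.
  move: E; rewrite /rescale nt => E.
  have v01 : unit_itv ((u - cumul s t) / trans s t).
    apply/andP; split; first by rewrite divr_ge0// subr_ge0.
    by rewrite ltr_pdivrMr// mul1r ltrBlDl.
  by move=> E2; apply/(abP _ v01); rewrite /cylinder /= /mkseq /= E2 E.
- move=> uab.
  have st : selects s u t.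
    case/andP: uab => h1 h2; rewrite /selects (le_trans _ h1) ?lerDl ?mulr_ge0//=.
    by rewrite (lt_le_trans h2)// lerD2l ler_piMr.
  have nt : next s u = t by apply/nextP.
  have /andP[h1 h2] := st.
  have tpos : 0 < trans s t by rewrite -(ltrD2l (cumul s t)) addr0 (le_lt_trans h1).
  have v01 : unit_itv ((u - cumul s t) / trans s t).
    apply/andP; split; first by rewrite divr_ge0// subr_ge0.
    by rewrite ltr_pdivrMr// mul1r ltrBlDl.
  move: uab; rewrite -rescale_itv// => /(abP _ v01).
  by rewrite /rescale nt /cylinder /= => ->.
Qed.

Let clip u : R := if 0 <= u < 1 then u else 0.

Let clip01 u : unit_itv (clip u).
Proof. by rewrite /clip /unit_itv; case: ifP => //; rewrite lexx ltr01. Qed.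

Let draw s : measurableTypeR R -> run_space M := fun u => read s (clip u).

Let draw_cylinder s w : exists a b : R, [/\ 0 <= a, a <= b, b <= 1,
  b - a = path_prob s w &
  draw s @^-1` cylinder (s :: w) = [set u | a <= clip u < b]].
Proof.
have [a [b [a0 ab b1 abE abP]]] := read_cylinder s w.
exists a, b; split => //; apply/seteqP; split => u /=.
  by move/(abP _ (clip01 u)).
by move=> h; apply/(abP _ (clip01 u)).
Qed.

Let measurable_clip : measurable_fun setT clip.
Proof.
apply: measurable_fun_if => //=.
by apply: measurable_and => //; [exact: measurable_fun_ler|exact: measurable_fun_ltr].
Qed.

Let draw_cylinder_neq s t w : t != s -> draw s @^-1` cylinder (t :: w) = set0.
Proof.
move=> ts; apply/seteqP; split => u //=.
by rewrite /cylinder /= readS => -[st]; rewrite st eqxx in ts.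
Qed.

Let measurable_draw s : measurable_fun setT (draw s).
Proof.
refine (@measurability _ _ _ (run_space M) _ _ (@cylinders R A M) _ _) => //.
move=> _ [_ [w _ <-] <-]; rewrite setTI.
case: w => [|t w]; first by rewrite (_ : _ @^-1` _ = setT) ?preimage_setT//; apply/seteqP.
have [->|ts] := eqVneq t s; last by rewrite draw_cylinder_neq.
have [a [b [_ _ _ _ ->]]] := draw_cylinder s w.
have -> : [set u | a <= clip u < b] = clip @^-1` `[a, b[%classic.
  by apply/seteqP; split => u /=; rewrite in_itv.
by rewrite -[X in measurable X]setTI; exact: measurable_clip.
Qed.

Let unit_set : set (measurableTypeR R) := `[0, 1[%classic.
Let munit : measurable unit_set. Proof. exact: measurable_itv. Qed.

Let lebesgue01 : {measure set (measurableTypeR R) -> \bar R} :=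
  mrestr (@lebesgue_measure R) munit.

Let lebesgue01_setT : lebesgue01 setT = 1%E.
Proof.
rewrite /lebesgue01 /= /mrestr setTI.
by rewrite lebesgue_measure_itv /= lte_fin ltr01 sube0.
Qed.

Lemma run_measure_exists s : exists mu, @is_run_measure R A M s mu.
Proof.
pose P01 : probability (measurableTypeR R) R :=
  HB.pack (Measure.sort lebesgue01)
    (Measure_isProbability.Build _ _ _ lebesgue01 lebesgue01_setT).
pose f : {mfun measurableTypeR R >-> run_space M} :=
  HB.pack (draw s) (isMeasurableFun.Build _ _ _ _ _ (measurable_draw s)).
exists (distribution P01 f) => w.
rewrite /distribution /pushforward /=.
have [a [b [a0 ab b1 abE ->]]] := draw_cylinder s w.
rewrite /lebesgue01 /= /mrestr.
have -> : [set u | a <= clip u < b] `&` unit_set = `[a, b[%classic.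
  apply/seteqP; split => u /=; rewrite /clip /unit_set /= !in_itv /=.
    by case=> + h; rewrite h.
  move=> /andP[au ub]; have -> : 0 <= u < 1.
    by rewrite (le_trans a0 au) (lt_le_trans ub b1).
  by rewrite au.
rewrite lebesgue_measure_itv /= lte_fin -abE.
move: ab; rewrite le_eqVlt => /orP[/eqP->|->]; first by rewrite ltxx subrr.
by rewrite EFinB.
Qed.

End run_measure_construction.

Section run_measure_theory.
Context (R : realType) (A : finType) (M : markov_chain R A).
Implicit Types (s t : state M) (w : seq (state M)).

Lemma measurable_cylinder w :
  measurable (cylinder w : set (run_space M)).
Proof. by apply: sub_sigma_algebra; exists w. Qed.

Lemma run_measure_unique s (mu nu : probability (run_space M) R) :
  is_run_measure s mu -> is_run_measure s nu ->
  forall E, measurable E -> mu E = nu E.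
Proof.
move=> mus nus.
have neq0 (m : probability (run_space M) R) t w : is_run_measure s m ->
    t != s -> m (cylinder (t :: w)) = 0%E.
  move=> ms ts; apply/eqP; rewrite -measure_le0.
  have <- : m (~` (cylinder [:: s] : set (run_space M))) = 0%E.
    rewrite probability_setC; last exact: measurable_cylinder.
    by rewrite ms /= subee.
  apply: le_measure; rewrite ?inE.
  - exact: measurable_cylinder.
  - by apply: measurableC; exact: measurable_cylinder.
  by move=> pi /= [pt _] [ps]; rewrite -pt ps eqxx in ts.
pose G : set (set (run_space M)) := [set C | @cylinders R A M C \/ C = set0].
apply: (measure_unique G (fun=> setT)) => //.
- apply/seteqP; split => C.
    apply: smallest_sub; first exact: smallest_sigma_algebra.
    by move=> D CD; apply: sub_sigma_algebra; left.
  apply: smallest_sub; first exact: sigma_algebra_measurable.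
  by move=> D [[w _ <-]| ->]; [exact: measurable_cylinder|exact: measurable0].
- have sub w v : (size w <= size v)%N -> G (cylinder w `&` cylinder v).
    move=> wv; have [E|E] := eqVneq (take (size w) v) w; [left|right].
      exists v => //; apply/seteqP; split => pi; last by case.
      move=> piv; split => //; rewrite /cylinder /= -[RHS]E -[in RHS]piv.
      by rewrite /mkseq -map_take take_iota (minn_idPl wv).
    apply/seteqP; split => pi //= -[piw piv]; move/eqP: E; apply.
    by rewrite -[in LHS]piv /mkseq -map_take take_iota (minn_idPl wv).
  move=> B C [[w _ <-]| ->] [[v _ <-]| ->]; rewrite ?set0I ?setI0; try by right.
  by case: (leqP (size w) (size v)) => [|/ltnW] /sub //; rewrite setIC.
- by move=> _; left; exists [::] => //; apply/seteqP.
- by rewrite bigcup_const//; exists 0%N.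
- move=> C [[[|t w] _ <-]| ->]; last by rewrite !measure0.
    have -> : cylinder [::] = [set: run_space M] by apply/seteqP.
    exact: (etrans (probability_setT mu) (esym (probability_setT nu))).
  have [->|ts] := eqVneq t s; first exact: (etrans (mus w) (esym (nus w))).
  exact: (etrans (neq0 mu t w mus ts) (esym (neq0 nu t w nus ts))).
- by move=> _; rewrite [ltLHS](probability_setT mu) ltry.
Qed.

Lemma measurable_coord (B : set (state M)) n :
  measurable ([set pi | B (pi n)] : set (run_space M)).
Proof.
have -> : [set pi | B (pi n)] = \bigcup_(w : seq (state M))
    if (size w == n.+1) && `[< B (last (init M) w) >] then cylinder w else set0.
  apply/seteqP; split => pi /=.
    move=> Bpi; exists (mkseq pi n.+1) => //.
    rewrite size_mkseq eqxx -nth_last size_mkseq nth_mkseq//= asboolT//.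
    by rewrite /cylinder /= size_map size_iota.
  case=> w _; case: ifPn => // /andP[/eqP wn /asboolP].
  by move=> + pw; rewrite -pw wn -nth_last size_mkseq nth_mkseq.
apply: countable_bigcupT_measurable => // w.
by case: ifP => _; [exact: measurable_cylinder|exact: measurable0].
Qed.

Lemma measurable_eventually (B : set (state M)) :
  measurable ([set pi | exists i, B (pi i)] : set (run_space M)).
Proof.
rewrite (_ : mkset _ = \bigcup_i [set pi | B (pi i)]); last first.
  by apply/seteqP; split=> pi [i]; [exists i|exists i].
by apply: bigcupT_measurable => i; exact: measurable_coord.
Qed.

Lemma measurable_always (B : set (state M)) :
  measurable ([set pi | forall i, B (pi i)] : set (run_space M)).
Proof.
rewrite (_ : mkset _ = \bigcap_i [set pi | B (pi i)]); last first.
  by apply/seteqP; split=> pi h i; [move=> _; exact: h|exact: (h i I)].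
by apply: bigcapT_measurable => i; exact: measurable_coord.
Qed.

End run_measure_theory.

Definition run_measure (R : realType) (A : finType) (M : markov_chain R A)
    (s : state M) : probability (run_space M) R :=
  sval (cid (run_measure_exists s)).

Lemma run_measureP (R : realType) (A : finType) (M : markov_chain R A)
  (s : state M) : is_run_measure s (run_measure s).
Proof. by rewrite /run_measure; case: cid. Qed.

Inductive bound_rel := AtLeast | MoreThan.

Definition threshold := {q : rat | 0 <= q <= 1}.

Definition threshold1 : threshold := exist _ (1 : rat) isT.

Inductive formula (A : finType) : Type :=
| Atom of A
| NegAtom of A
| And of formula A & formula A
| Or of formula A & formula A
| Finally of bound_rel & threshold & formula A
| Globally of bound_rel & threshold & formula A.

Arguments Finally {A} c q phi.
Arguments Globally {A} c q phi.

(* Number of symbols of a formula: a proposition, a negation, a connective and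
   a temporal operator together with its bound each count for one. *)
Fixpoint formula_length (A : finType) (phi : formula A) : nat :=
  match phi with
  | Atom _ => 1
  | NegAtom _ => 2
  | And phi1 phi2 | Or phi1 phi2 =>
      (formula_length phi1 + formula_length phi2).+1
  | Finally _ _ phi1 | Globally _ _ phi1 => (formula_length phi1).+1
  end.

Definition meets_bound (R : realType) (c : bound_rel) (x : \bar R)
    (q : threshold) : Prop :=
  match c with
  | AtLeast => ((ratr (val q))%:E <= x)%E
  | MoreThan => ((ratr (val q))%:E < x)%E
  end.

Fixpoint sat (R : realType) (A : finType) (M : markov_chain R A)
    (s : state M) (phi : formula A) : Prop :=
  match phi with
  | Atom a => a \in label s
  | NegAtom a => a \notin label s
  | And phi1 phi2 => sat s phi1 /\ sat s phi2
  | Or phi1 phi2 => sat s phi1 \/ sat s phi2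
  | Finally c q phi1 =>
      meets_bound c (run_measure s [set pi | exists i, sat (pi i) phi1]) q
  | Globally c q phi1 =>
      meets_bound c (run_measure s [set pi | forall i, sat (pi i) phi1]) q
  end.

Definition is_model (R : realType) (A : finType) (M : markov_chain R A)
  (phi : formula A) : Prop := sat (init M) phi.

Definition satisfiable (R : realType) (A : finType) (phi : formula A) : Prop :=
  exists M : markov_chain R A, is_model M phi.

Inductive F1_G1_or (A : finType) : formula A -> Prop :=
| F1_G1_or_atom a : F1_G1_or (Atom a)
| F1_G1_or_negatom a : F1_G1_or (NegAtom a)
| F1_G1_or_and psi1 psi2 :
    F1_G1_or psi1 -> F1_G1_or psi2 -> F1_G1_or (And psi1 psi2)
| F1_G1_or_or psi1 psi2 :
    F1_G1_or psi1 -> F1_G1_or psi2 -> F1_G1_or (Or psi1 psi2)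
| F1_G1_or_finally psi :
    F1_G1_or psi -> F1_G1_or (Finally AtLeast threshold1 psi)
| F1_G1_or_globally psi :
    F1_G1_or psi -> F1_G1_or (Globally AtLeast threshold1 psi).

Inductive Fq1_G1_or (A : finType) : formula A -> Prop :=
| Fq1_G1_or_atom a : Fq1_G1_or (Atom a)
| Fq1_G1_or_negatom a : Fq1_G1_or (NegAtom a)
| Fq1_G1_or_and phi1 phi2 :
    Fq1_G1_or phi1 -> Fq1_G1_or phi2 -> Fq1_G1_or (And phi1 phi2)
| Fq1_G1_or_or phi1 phi2 :
    Fq1_G1_or phi1 -> Fq1_G1_or phi2 -> Fq1_G1_or (Or phi1 phi2)
| Fq1_G1_or_finally c q phi : Fq1_G1_or phi -> Fq1_G1_or (Finally c q phi)
| Fq1_G1_or_globally psi :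
    F1_G1_or psi -> Fq1_G1_or (Globally AtLeast threshold1 psi).

Definition rooted_tree (S : eqType) (r : S) (e : rel S) : Prop :=
  forall s, exists! p : seq S, path e r p /\ last r p = s.

Definition tree_height (S : eqType) (r : S) (e : rel S) (h : nat) : Prop :=
  (forall p, path e r p -> (size p <= h)%N) /\
  (exists2 p, path e r p & size p = h).

Definition tree_ancestor (S : eqType) (e : rel S) (t s : S) : Prop :=
  exists2 p, path e t p & last t p = s.

(* e is the set of tree edges; tree_ancestor is reflexive, so that self-loops
   are back edges. *)
Definition has_height (R : realType) (A : finType) (M : markov_chain R A)
    (h : nat) : Prop :=
  exists e : rel (state M),
    [/\ rooted_tree (init M) e,
        tree_height (init M) e h,
        forall s t, e s t -> 0 < trans s t &
        forall s t, 0 < trans s t -> e s t \/ tree_ancestor e t s].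

(* Main.v *)
(* Let M be a model of phi, P a list of bodies of F-subformulas that are still
   to be reached, and x a state of M. The runs of M from x are cut at the first
   visit of a state x' satisfying some member of P: then P is updated by
   replacing the satisfied members by the bodies of their own outermost
   F-subformulas, which can happen at most a times, where a is the number of F
   outside G. By the strong Markov property the reachability probabilities of
   the members of P are preserved when the path from x to x' is shortened.

   Below G all formulas are qualitative, so that a shortened path is harmless
   as soon as it keeps the last occurrence of each of the b bodies of F below G:
   F_{=1} psi travels along a path of M until psi is met, and the true formulas
   G_{=1} psi only increase along it. The probability of never visiting such an
   x' is sent to one lasso: a shortened path from x to a state t at which the
   set of true G-formulas is maximal among the reachable states, followed by a
   cycle through t and one witness, reachable from t, of each possible F-body.

   The resulting height is at most a (b + 1) + 2 b + 1, and a + b < |phi|. *)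
Require Import Defs.
From HB Require Import structures.
From mathcomp Require Import all_boot all_order all_algebra.
From mathcomp Require Import all_classical all_reals all_analysis.
From mathcomp Require Import zify lra.

Set Implicit Arguments.
Unset Strict Implicit.
Unset Printing Implicit Defensive.

Import Order.TTheory GRing.Theory Num.Theory.

Local Open Scope classical_set_scope.
Local Open Scope ring_scope.

(** * Sums of nonnegative extended reals over arbitrary index sets *)

Section esum_complements.
Local Open Scope ereal_scope.
Context {R : realType}.

Lemma esum_le_ub (T : choiceType) (I : set T) (a : T -> \bar R) x :
  (forall X, fsets I X -> \sum_(i \in X) a i <= x) -> \esum_(i in I) a i <= x.
Proof. by move=> h; apply: ge_ereal_sup => _ [X IX <-]; exact: h. Qed.

Lemma esumZl (T : choiceType) (I : set T) (a : T -> \bar R) (c : R) :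
  (0 <= c)%R -> (forall i, 0 <= a i) ->
  \esum_(i in I) (c%:E * a i) = c%:E * \esum_(i in I) a i.
Proof.
have le (d : R) (b : T -> \bar R) : (0 <= d)%R -> (forall i, 0 <= b i) ->
    \esum_(i in I) (d%:E * b i) <= d%:E * \esum_(i in I) b i.
  move=> d0 b0; apply: esum_le_ub => X [finX XI].
  rewrite -ge0_mule_fsumr//.
  apply: lee_wpmul2l; first by rewrite lee_fin.
  by apply: esum_ge; exists X.
move=> c0 a0; apply/eqP; rewrite eq_le le//=.
have [<-|c0'] := eqVneq 0%R c.
  by rewrite mul0e; apply: esum_ge0 => i _; rewrite mul0e.
have {c0'}c0 : (0 < c)%R by rewrite lt_neqAle c0'.
have ic0 : (0 <= c^-1)%R by rewrite invr_ge0 ltW.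
(* The converse inequality is the one already proved, for the scalar [c^-1] and the family
   [c * a]. *)
have := le c^-1%R (fun i => c%:E * a i) ic0.
have -> : \esum_(i in I) (c^-1%:E * (c%:E * a i)) = \esum_(i in I) a i.
  by apply: eq_esum => i _; rewrite muleA -EFinM mulVf ?mul1e// gt_eqF.
move=> /(_ (fun i => mule_ge0 (ltW c0 : 0 <= c%:E) (a0 i))) h.
apply: (@le_trans _ _ (c%:E * (c^-1%:E * \esum_(i in I) (c%:E * a i)))).
  by apply: lee_wpmul2l => //; rewrite lee_fin ltW.
by rewrite muleA -EFinM mulfV ?mul1e// gt_eqF.
Qed.

Lemma esum_subset (T : choiceType) (I J : set T) (a : T -> \bar R) :
  I `<=` J -> (forall i, J i -> 0 <= a i) ->
  \esum_(i in I) a i <= \esum_(i in J) a i.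
Proof.
move=> IJ a0; rewrite [leLHS]esum_mkcond [leRHS]esum_mkcond; apply: le_esum => i _.
case: ifPn => [|_]; first by rewrite inE => /IJ; rewrite -inE => ->.
by case: ifPn => //; rewrite inE; exact: a0.
Qed.

Lemma esum_ge_term (T : choiceType) (I : set T) (a : T -> \bar R) t :
  I t -> (forall i, I i -> 0 <= a i) -> a t <= \esum_(i in I) a i.
Proof.
move=> It a0; rewrite -[leLHS]esum_set1 ?a0//.
by apply: esum_subset => // _ ->.
Qed.

Lemma esum_term0 (T : choiceType) (I : set T) (a : T -> \bar R) t :
  I t -> (forall i, I i -> 0 <= a i) -> \esum_(i in I) a i = 0 -> a t = 0.
Proof.
by move=> It a0 s0; apply/eqP; rewrite eq_le a0// -[leRHS]s0 esum_ge_term.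
Qed.

Lemma esum_fibers (O T : choiceType) (f : O -> T) (a : O -> \bar R) :
  (forall o, 0 <= a o) ->
  \esum_(t in [set: T]) \esum_(o in [set o | f o = t]) a o =
  \esum_(o in [set: O]) a o.
Proof.
move=> a0; rewrite esum_esum//; 
apply: (@reindex_esum _ _ _ setT _ (fun o => (f o, o)) (fun k => a k.2)).
split=> //= [x y _ _ [_ ->]//|[t o] [_ /= <-]]; by exists o.
Qed.

Lemma esum_option (T : choiceType) (a : option T -> \bar R) :
  (forall o, 0 <= a o) ->
  \esum_(o in [set: option T]) a o =
  a None + \esum_(t in [set: T]) a (Some t).
Proof.
move=> a0; rewrite (esumID [set None])// setTI esum_set1//; congr (_ + _).
rewrite setTI -(@esum_image _ _ _ setT Some); last by move=> x y _ _ [].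
congr esum; apply/seteqP; split=> [[t _|/(_ erefl)//]|_ [t _ <-]//].
by exists t.
Qed.

(** Countable additivity over [nat] is transported along [pickle]; a number that codes no index gets
    the empty set. *)
Lemma measure_countable_bigcup d (T : measurableType d)
    (mu : {measure set T -> \bar R}) (I : countType) (D : set I)
    (F : I -> set T) :
  (forall i, D i -> measurable (F i)) -> trivIset D F ->
  mu (\bigcup_(i in D) F i) = \esum_(i in D) mu (F i).
Proof.
move=> mF tF.
pose G n := if pickle_inv n is Some i then F i else set0.
have GE i : G (pickle i) = F i by rewrite /G pickleK_inv.
have -> : \bigcup_(i in D) F i = \bigcup_(n in pickle @` D) G n.
  by rewrite bigcup_image; apply: eq_bigcupr => i _; rewrite GE.
rewrite measure_bigcup; first last.
- move=> _ _ [i Di <-] [j Dj <-]; rewrite !GE => /(tF _ _ Di Dj) -> //.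
- by move=> _ [i Di <-]; rewrite GE; exact: mF.
rewrite nneseries_esum//; rewrite set_mem_set esum_image.
  by apply: eq_esum => i _; rewrite GE.
by move=> x y _ _; exact: (pcan_inj pickleK).
Qed.

End esum_complements.

(** * Hitting probabilities *)

Section hitting.
Context (R : realType) (A : finType) (M : markov_chain R A).
Local Open Scope ereal_scope.
Implicit Types (s t : state M) (w : seq (state M)) (B : set (state M)).

Definition hitp s B : \bar R :=
  run_measure s [set pi | exists i, B (pi i)].

(** The words by which a run from [s] can first enter [B]. None is a proper prefix of another, so
    their cylinders are disjoint. *)
Fixpoint first_hit B s w : Prop :=
  if w is t :: w' then ~ B s /\ first_hit B t w' else B s.

(** The expectation of [f] at the first visit to [B], runs that avoid [B] contributing 0. *)
Definition hitsum B (f : state M -> \bar R) s : \bar R :=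
  \esum_(w in first_hit B s) ((path_prob s w)%:E * f (last s w)).

Lemma path_prob_ge0 s w : (0 <= path_prob s w)%R.
Proof. by elim: w s => //= t w IH s; rewrite mulr_ge0// trans_ge0. Qed.

Lemma path_prob_path s w :
  (0 < path_prob s w)%R -> path (fun u v => 0 < trans u v)%R s w.
Proof.
elim: w s => //= t w IH s; case: (ltP 0%R (trans s t)) => [st|].
  by rewrite pmulr_rgt0// => /IH.
move=> st; have -> : trans s t = 0%R by apply/eqP; rewrite eq_le st trans_ge0.
by rewrite mul0r ltxx.
Qed.

Lemma first_hit_last B s w : first_hit B s w -> B (last s w).
Proof. by elim: w s => //= t w IH s [_ /IH]. Qed.

Lemma mkseq_behead (T : Type) (f : nat -> T) n :
  mkseq f n.+1 = f 0%N :: mkseq (fun i => f i.+1) n.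
Proof. by rewrite /mkseq /= -[1%N]addn0 iotaDl -map_comp. Qed.

Lemma first_hit_run B (pi : run M) n :
  first_hit B (pi 0%N) (mkseq (fun i => pi i.+1) n) <->
  B (pi n) /\ (forall j, (j < n)%N -> ~ B (pi j)).
Proof.
elim: n pi => [|n IH] pi; first by split => // -[].
rewrite mkseq_behead /= (IH (fun i => pi i.+1)); split.
  by case=> nB [Bn h]; split=> // -[|j] // /h.
by case=> Bn h; split; [exact: h|split=> // j jn; exact: h].
Qed.

Lemma cylinder_consE s w (pi : run M) :
  cylinder (s :: w) pi <-> pi 0%N = s /\ mkseq (fun i => pi i.+1) (size w) = w.
Proof.
rewrite /cylinder /mkset mkseq_behead.
by split=> [[-> ->]|[-> ->]].
Qed.

Lemma hitpE s B : hitp s B = hitsum B (fun=> 1) s.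
Proof.
have mE := @measurable_eventually R A M B.
have mC := @measurable_cylinder R A M.
rewrite /hitp /hitsum; set E := mkset _ in mE *.
(* Runs that do not start in [s] form a null set. *)
have -> : run_measure s E = run_measure s (E `&` cylinder [:: s]).
  have e1 : run_measure s (E `&` ~` cylinder [:: s]) = 0.
    apply/eqP; rewrite -measure_le0.
    have <- : run_measure s (~` cylinder [:: s]) = 0.
      by rewrite probability_setC// run_measureP /= subee.
    by apply: le_measure; rewrite ?inE//;
      [apply: measurableI => //|]; apply: measurableC.
  rewrite -[in LHS](setUIDK E (cylinder [:: s])) measureU.
  - by rewrite [X in _ + X](_ : _ = 0) ?adde0// -[RHS]e1 setDE.
  - exact: measurableI.
  - exact: measurableD.
  - by apply/seteqP; split => pi //= [[_ h] [_ /(_ h)]].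
have -> : E `&` cylinder [:: s] = \bigcup_(w in first_hit B s) cylinder (s :: w).
  apply/seteqP; split => pi.
    move=> [[i Bi]] /cylinder_consE[p0 _].
    have ex : exists i, `[< B (pi i) >] by exists i; apply/asboolP.
    case: (ex_minnP ex) => n /asboolP Bn nmin.
    exists (mkseq (fun i => pi i.+1) n).
      by rewrite -p0; apply/first_hit_run; split=> // j jn /asboolP/nmin; lia.
    by apply/cylinder_consE; rewrite size_mkseq.
  move=> [w fw cw]; have /cylinder_consE[p0 pw] := cw; split.
    move: fw; rewrite -p0 -pw => /first_hit_run[Bn _]; by exists (size w).
  exact/cylinder_consE.
rewrite measure_countable_bigcup//; last first.
  move=> w v fw fv [pi [/cylinder_consE[p0 pw] /cylinder_consE[_ pv]]].
  move: fw fv; rewrite -{1}pw -{1}pv -p0 => /first_hit_run[Bw nw] /first_hit_run[Bv nv].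
  have e : size w = size v.
    by case: (ltngtP (size w) (size v)) => // [/nv|/nw].
  by rewrite -pw -pv e.
by apply: eq_esum => w _; rewrite mule1; exact: run_measureP.
Qed.

(** First-step analysis: a nonempty word is split into its first letter and the rest. *)
Lemma esum_cons (J : state M -> set (seq (state M))) (f : state M -> \bar R) s :
  (forall t, 0 <= f t) ->
  \esum_(w in [set w | if w is t :: w' then J t w' else False])
     ((path_prob s w)%:E * f (last s w)) =
  \esum_(t in [set: state M])
     ((trans s t)%:E *
        \esum_(w in J t) ((path_prob t w)%:E * f (last t w))).
Proof.
move=> f0.
have p0 t w : 0 <= (path_prob t w)%:E * f (last t w).
  by rewrite mule_ge0// lee_fin path_prob_ge0.
transitivity (\esum_(t in [set: state M]) \esum_(w in J t)
    ((trans s t)%:E * ((path_prob t w)%:E * f (last t w)))); last first.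
  by apply: eq_esum => t _; rewrite esumZl// trans_ge0.
rewrite esum_esum; last by move=> t w _ _; rewrite mule_ge0// lee_fin trans_ge0.
rewrite (@reindex_esum _ _ _ (setT `*`` J) _ (fun k => k.1 :: k.2)).
  by apply: eq_esum => -[t w] _ /=; rewrite EFinM muleA.
split=> [[t w] [_ /=]//|[t w] [t' w'] _ _ /= [-> ->]//|[//|t w] /= Jw].
by exists (t, w).
Qed.

Section hitsum_theory.
Variables (B : set (state M)) (f : state M -> \bar R).
Hypothesis f0 : forall t, 0 <= f t.

Lemma hitsum_ge0 s : 0 <= hitsum B f s.
Proof. by apply: esum_ge0 => w _; rewrite mule_ge0// lee_fin path_prob_ge0. Qed.

Lemma hitsum_in s : B s -> hitsum B f s = f s.
Proof.
move=> Bs; rewrite /hitsum; have -> : first_hit B s = [set [::]].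
  by apply/seteqP; split=> [[|t w] /=|_ ->//]; [|case].
by rewrite esum_set1 /= mul1e.
Qed.

Lemma hitsum_notin s : ~ B s ->
  hitsum B f s = \esum_(t in [set: state M]) ((trans s t)%:E * hitsum B f t).
Proof.
move=> nBs; rewrite -esum_cons//; congr esum; apply/seteqP.
by split=> -[|t w] //= [].
Qed.

(** Minimality among supersolutions: the sums over words of bounded length stay below [g] by
    induction on the bound, and every finite set of words has bounded length. Most later comparisons
    of hitting probabilities come from here by a choice of [g]. *)
Lemma hitsum_min (g : state M -> \bar R) :
  (forall t, 0 <= g t) -> (forall t, B t -> f t <= g t) ->
  (forall t, ~ B t ->
     \esum_(u in [set: state M]) ((trans t u)%:E * g u) <= g t) ->
  forall s, hitsum B f s <= g s.
Proof.
move=> g0 gB gS.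
have pf0 s w : 0 <= (path_prob s w)%:E * f (last s w).
  by rewrite mule_ge0// lee_fin path_prob_ge0.
pose D n s := [set w | first_hit B s w /\ (size w <= n)%N].
have Dle n s : \esum_(w in D n s) ((path_prob s w)%:E * f (last s w)) <= g s.
  elim: n s => [|n IH] s.
    case: (pselect (B s)) => Bs.
      apply: (le_trans _ (gB _ Bs)); rewrite -(hitsum_in Bs).
      by apply: esum_subset => // w [].
    rewrite (_ : D 0%N s = set0) ?esum_set0//; apply/seteqP.
    by split=> // -[|t w] [].
  case: (pselect (B s)) => Bs.
    apply: (le_trans _ (gB _ Bs)); rewrite -(hitsum_in Bs).
    by apply: esum_subset => // w [].
  apply: (le_trans _ (gS _ Bs)).
  rewrite (_ : D n.+1 s = [set w | if w is t :: w' then D n t w' else False]).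
    rewrite esum_cons//; apply: le_esum => t _.
    by apply: lee_wpmul2l => //; rewrite lee_fin trans_ge0.
  by apply/seteqP; split=> -[|t w] => [[]//|[[_ ? ?]]//|//|[? ?]]; split.
move=> s; apply: esum_le_ub => X [finX XB].
have [n Xn] : exists n, forall w, X w -> (size w <= n)%N.
  have /finite_seqP[l lX] := finX.
  exists (\max_(w <- l) size w)%N => w Xw.
  by apply: (@leq_bigmax_seq _ l xpredT size) => //; move: Xw; rewrite lX.
apply: le_trans (Dle n s); apply: esum_ge; exists X => //.
by split=> // w Xw; split; [exact: XB|exact: Xn].
Qed.

End hitsum_theory.

Lemma hitp_ge0 s B : 0 <= hitp s B.
Proof. exact: measure_ge0. Qed.

Lemma hitp_le1 s B : hitp s B <= 1.
Proof. by apply: probability_le1; exact: measurable_eventually. Qed.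

Lemma hitp_fin_num s B : hitp s B \is a fin_num.
Proof. by rewrite ge0_fin_numE ?hitp_ge0// (le_lt_trans (hitp_le1 _ _))// ltry. Qed.

Lemma hitp_in s B : B s -> hitp s B = 1.
Proof. by move=> Bs; rewrite hitpE hitsum_in. Qed.

Lemma hitp_notin s B : ~ B s ->
  hitp s B = \esum_(t in [set: state M]) ((trans s t)%:E * hitp t B).
Proof.
by move=> Bs; rewrite hitpE hitsum_notin//; apply: eq_esum => t _; rewrite hitpE.
Qed.

Lemma hitp_min B (g : state M -> \bar R) :
  (forall t, 0 <= g t) -> (forall t, B t -> 1 <= g t) ->
  (forall t, ~ B t ->
     \esum_(u in [set: state M]) ((trans t u)%:E * g u) <= g t) ->
  forall s, hitp s B <= g s.
Proof. by move=> g0 gB gS s; rewrite hitpE; exact: hitsum_min. Qed.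

Lemma hitp_superharmonic s B :
  \esum_(t in [set: state M]) ((trans s t)%:E * hitp t B) <= hitp s B.
Proof.
case: (pselect (B s)) => [Bs|/hitp_notin->//].
rewrite hitp_in// -(trans_sum1 s); apply: le_esum => t _.
by rewrite -[leRHS]mule1 lee_wpmul2l ?hitp_le1// lee_fin trans_ge0.
Qed.

Lemma le_hitp s B C : B `<=` C -> hitp s B <= hitp s C.
Proof.
move=> BC; apply: le_measure; rewrite ?inE; try exact: measurable_eventually.
by move=> pi [i Bi]; exists i; exact: BC.
Qed.

(** The right-hand side on [I], extended by 1 outside [I], is a supersolution because [I] is
    closed. *)
Lemma hitp_invariant (I B : set (state M)) :
  (forall s t, I s -> (0 < trans s t)%R -> I t) ->
  forall s, I s -> hitp s B <= hitp s (B `&` I).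
Proof.
move=> Iinv s Is.
pose g t := if `[< I t >] then hitp t (B `&` I) else 1.
have -> : hitp s (B `&` I) = g s by rewrite /g asboolT.
apply: hitp_min => [t|t Bt|t nBt]; rewrite /g; case: asboolP => It //.
- by rewrite hitp_in.
- apply: le_trans (hitp_superharmonic _ _); apply: le_esum => u _.
  have := trans_ge0 t u; rewrite le_eqVlt => /orP[/eqP<-|tu]; first by rewrite !mul0e.
  by rewrite asboolT//; exact: (Iinv t).
rewrite -[leRHS](trans_sum1 t); apply: le_esum => u _.
rewrite -[leRHS]mule1 lee_wpmul2l ?lee_fin ?trans_ge0//.
by case: ifP => // _; exact: hitp_le1.
Qed.

(** A run that reaches [B] has a first visit to [H], from which it has to reach [B]. The right-hand
    side is a supersolution for [B]. *)
Lemma strong_markov (H B : set (state M)) : B `<=` H ->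
  forall s, hitp s B <= hitsum H (hitp^~ B) s.
Proof.
move=> BH.
have h0 t : 0 <= hitp t B by exact: hitp_ge0.
(* The reverse inequality serves to verify the supersolution property at points of [H] outside
   [B]. *)
have le s : hitsum H (hitp^~ B) s <= hitp s B.
  by apply: (hitsum_min h0 h0) => // t _; exact: hitp_superharmonic.
apply: hitp_min => [t|t Bt|t nBt]; first exact: hitsum_ge0.
  by rewrite hitsum_in ?hitp_in//; exact: BH.
case: (pselect (H t)) => Ht; last by rewrite -hitsum_notin.
rewrite hitsum_in// [leRHS]hitp_notin//; apply: le_esum => u _.
by apply: lee_wpmul2l => //; rewrite lee_fin trans_ge0.
Qed.

(** An average of numbers at most 1 equals 1 only if every number of positive weight is 1; the
    weighted sum of the defects [1 - hitp u B] vanishes. *)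
Lemma hitp1_step s t B :
  1 <= hitp s B -> ~ B s -> (0 < trans s t)%R -> 1 <= hitp t B.
Proof.
move=> h1 nBs st; move: h1; rewrite hitp_notin// => h1.
have d0 u : 0 <= 1 - hitp u B by rewrite sube_ge0 ?hitp_le1// hitp_fin_num.
have e : 1 = \esum_(u in [set: state M]) ((trans s u)%:E * hitp u B) +
   \esum_(u in [set: state M]) ((trans s u)%:E * (1 - hitp u B)).
  rewrite -esumD; last 2 first.
  - by move=> u _; rewrite mule_ge0 ?hitp_ge0// lee_fin trans_ge0.
  - by move=> u _; rewrite mule_ge0// lee_fin trans_ge0.
  rewrite -[LHS](trans_sum1 s); apply: eq_esum => u _.
  rewrite -ge0_muleDr ?hitp_ge0// addeC subeK ?mule1//; exact: hitp_fin_num.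
have z : \esum_(u in [set: state M]) ((trans s u)%:E * (1 - hitp u B)) = 0.
  apply/eqP; rewrite eq_le; apply/andP; split; last first.
    by apply: esum_ge0 => u _; rewrite mule_ge0// lee_fin trans_ge0.
  by rewrite -(@leeD2lE _ 1)// adde0 [leRHS]e leeD2r.
have := @esum_term0 _ _ _ _ t I _ z => /(_ (fun u _ =>
  mule_ge0 (trans_ge0 s u : 0 <= (trans s u)%:E) (d0 u))) /eqP.
rewrite mule_eq0 eqe gt_eqF//= => /eqP e0.
by rewrite -sube_le0 e0.
Qed.

Lemma hitp_gt0_path s B : 0 < hitp s B ->
  exists2 w, path (fun u v => 0 < trans u v)%R s w & B (last s w).
Proof.
move=> h0; apply: contrapT => no.
suff : hitp s B = 0 by move=> e; rewrite e ltxx in h0.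
rewrite hitpE; apply: esum1 => w fw; rewrite mule1.
have := path_prob_ge0 s w; rewrite le_eqVlt => /orP[/eqP<-//|/path_prob_path pw].
by exfalso; apply: no; exists w => //; exact: first_hit_last fw.
Qed.

(** * Safety events as complements of hitting events *)

Lemma always_hitp s B :
  run_measure s [set pi | forall i, B (pi i)] = 1 - hitp s (~` B).
Proof.
rewrite /hitp -probability_setC; last exact: measurable_eventually.
congr (run_measure s _); apply/seteqP; split=> pi /= h; first by case=> i; apply.
by move=> i; apply: contrapT => nB; apply: h; exists i.
Qed.

Lemma always1P s B :
  1 <= run_measure s [set pi | forall i, B (pi i)] <-> hitp s (~` B) = 0.
Proof.
rewrite always_hitp; split=> [h|->]; last by rewrite sube0.
apply/eqP; rewrite eq_le hitp_ge0 andbT.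
move: h (hitp_ge0 s (~` B)) (hitp_fin_num s (~` B)).
case: (hitp s (~` B)) => [r| |]//= h _ _.
by move: h; rewrite -EFinB !lee_fin; lra.
Qed.

Lemma always1_in s B :
  1 <= run_measure s [set pi | forall i, B (pi i)] -> B s.
Proof.
move=> /always1P h; apply: contrapT => nB.
by move: h; rewrite hitp_in// => /eqP; rewrite eqe oner_eq0.
Qed.

Lemma always1_step s t B :
  1 <= run_measure s [set pi | forall i, B (pi i)] -> (0 < trans s t)%R ->
  1 <= run_measure t [set pi | forall i, B (pi i)].
Proof.
move=> h1 st; have Bs := always1_in h1; move: h1 => /always1P h; apply/always1P.
move: h; rewrite hitp_notin// => h.
have := @esum_term0 _ _ _ _ t I _ h => /(_ (fun u _ =>
  mule_ge0 (trans_ge0 s u : 0 <= (trans s u)%:E) (hitp_ge0 u _))) /eqP.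
by rewrite mule_eq0 eqe gt_eqF//= => /eqP.
Qed.

Lemma always1_invariant (I B : set (state M)) :
  (forall s t, I s -> (0 < trans s t)%R -> I t) -> I `<=` B ->
  forall s, I s -> 1 <= run_measure s [set pi | forall i, B (pi i)].
Proof.
move=> Iinv IB s Is; apply/always1P/eqP; rewrite eq_le hitp_ge0 andbT.
apply: (le_trans (hitp_invariant _ Iinv Is)).
rewrite hitpE (_ : _ `&` _ = set0); last by apply/seteqP; split=> t // [nB /IB].
by rewrite /hitsum esum1// => w /first_hit_last.
Qed.

End hitting.


(** * Countability of formulas, branching chains and restrictions *)

Lemma meets_bound_le (R : realType) c (x y : \bar R) q :
  (x <= y)%E -> meets_bound c x q -> meets_bound c y q.
Proof. by case: c => /= xy h; [exact: le_trans xy|exact: lt_le_trans xy]. Qed.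

Section formula_countable.
Context (A : finType).

(** The states of the unfolded chain carry lists of formulas, and a Markov chain needs a countable
    state space. *)
Fixpoint formula_encode (phi : formula A) : GenTree.tree (A + threshold) :=
  match phi with
  | Atom a => GenTree.Node 0 [:: GenTree.Leaf (inl a)]
  | NegAtom a => GenTree.Node 1 [:: GenTree.Leaf (inl a)]
  | And f g => GenTree.Node 2 [:: formula_encode f; formula_encode g]
  | Or f g => GenTree.Node 3 [:: formula_encode f; formula_encode g]
  | Finally AtLeast q f => GenTree.Node 4 [:: GenTree.Leaf (inr q); formula_encode f]
  | Finally MoreThan q f => GenTree.Node 5 [:: GenTree.Leaf (inr q); formula_encode f]
  | Globally AtLeast q f => GenTree.Node 6 [:: GenTree.Leaf (inr q); formula_encode f]
  | Globally MoreThan q f => GenTree.Node 7 [:: GenTree.Leaf (inr q); formula_encode f]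
  end.

Fixpoint formula_decode (t : GenTree.tree (A + threshold)) : option (formula A) :=
  match t with
  | GenTree.Node 0 [:: GenTree.Leaf (inl a)] => Some (Atom a)
  | GenTree.Node 1 [:: GenTree.Leaf (inl a)] => Some (NegAtom a)
  | GenTree.Node 2 [:: t1; t2] =>
      obind (fun f => omap (And f) (formula_decode t2)) (formula_decode t1)
  | GenTree.Node 3 [:: t1; t2] =>
      obind (fun f => omap (Or f) (formula_decode t2)) (formula_decode t1)
  | GenTree.Node 4 [:: GenTree.Leaf (inr q); t1] =>
      omap (Finally AtLeast q) (formula_decode t1)
  | GenTree.Node 5 [:: GenTree.Leaf (inr q); t1] =>
      omap (Finally MoreThan q) (formula_decode t1)
  | GenTree.Node 6 [:: GenTree.Leaf (inr q); t1] =>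
      omap (Globally AtLeast q) (formula_decode t1)
  | GenTree.Node 7 [:: GenTree.Leaf (inr q); t1] =>
      omap (Globally MoreThan q) (formula_decode t1)
  | _ => None
  end.

Lemma formula_encodeK : pcancel formula_encode formula_decode.
Proof.
elim=> //= [f -> g ->|f -> g ->|[] q f IH|[] q f IH] //=; by rewrite IH.
Qed.

HB.instance Definition _ := Countable.copy (formula A) (pcan_type formula_encodeK).

End formula_countable.

(** * Markov chains driven by countably many weighted outcomes *)

Section branching_chain.
Context (R : realType) (A : finType) (X O : countType).
Context (succ : X -> O -> X) (wt : X -> O -> R) (x0 : X) (lab : X -> {set A}).
Hypothesis wt_ge0 : forall x o, 0 <= wt x o.
Hypothesis wt_sum1 : forall x, (\esum_(o in [set: O]) (wt x o)%:E = 1)%E.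

(** Distinct outcomes may lead to the same successor, so weights are collected over the fibre of
    [y]. *)
Definition branch_trans (x y : X) : R :=
  fine (\esum_(o in [set o | succ x o = y]) (wt x o)%:E).

Lemma branch_transE x y :
  (branch_trans x y)%:E = (\esum_(o in [set o | succ x o = y]) (wt x o)%:E)%E.
Proof.
rewrite fineK// ge0_fin_numE; last by apply: esum_ge0 => o _; rewrite lee_fin.
apply: (@le_lt_trans _ _ 1%E); last exact: ltry.
by rewrite -(wt_sum1 x); apply: esum_subset => // o _; rewrite lee_fin.
Qed.

Lemma branch_trans_ge0 x y : 0 <= branch_trans x y.
Proof. by rewrite fine_ge0// esum_ge0// => o _; rewrite lee_fin. Qed.

Lemma branch_trans_le1 x y : branch_trans x y <= 1.
Proof.
rewrite -lee_fin branch_transE -(wt_sum1 x).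
by apply: esum_subset => // o _; rewrite lee_fin.
Qed.

Lemma branch_sum x (g : X -> \bar R) :
  (forall y, 0 <= g y)%E -> (forall y, g y \is a fin_num) ->
  (\esum_(y in [set: X]) ((branch_trans x y)%:E * g y) =
   \esum_(o in [set: O]) ((wt x o)%:E * g (succ x o)))%E.
Proof.
move=> g0 gfin; rewrite -[RHS](@esum_fibers _ _ _ (succ x)); last first.
  by move=> o; rewrite mule_ge0// lee_fin.
apply: eq_esum => y _; rewrite branch_transE muleC -(fineK (gfin y)) -esumZl.
- by apply: eq_esum => o /= ->; rewrite fineK// muleC.
- by rewrite fine_ge0.
- by move=> o; rewrite lee_fin.
Qed.

Lemma branch_trans_sum1 x :
  (\esum_(y in [set: X]) (branch_trans x y)%:E = 1)%E.
Proof.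
have := @branch_sum x (fun=> 1%E) (fun=> lee01) (fun=> erefl).
under eq_esum do rewrite mule1.
by under [X in _ = X -> _]eq_esum do rewrite mule1; rewrite wt_sum1.
Qed.

Definition branch_chain : markov_chain R A :=
  MarkovChain branch_trans_ge0 branch_trans_le1 branch_trans_sum1 x0 lab.

Lemma branch_trans_succ x o : 0 < wt x o -> 0 < branch_trans x (succ x o).
Proof.
move=> o0; rewrite -lte_fin branch_transE.
apply: (@lt_le_trans _ _ (wt x o)%:E); first by rewrite lte_fin.
by apply: esum_ge_term => // ? _; rewrite lee_fin.
Qed.

Lemma branch_trans_gt0 x y :
  0 < branch_trans x y -> exists2 o, succ x o = y & 0 < wt x o.
Proof.
move=> xy; apply: contrapT => no.
suff e : (branch_trans x y)%:E = 0%E.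
  by move: xy; rewrite -lte_fin e ltxx.
rewrite branch_transE esum1// => o so.
have := wt_ge0 x o; rewrite le_eqVlt => /orP[/eqP<-//|o0].
by exfalso; apply: no; exists o.
Qed.

Lemma hitp_branch_superharmonic x (B : set X) :
  (\esum_(o in [set: O])
     ((wt x o)%:E * hitp (succ x o : state branch_chain) B) <=
   hitp (x : state branch_chain) B)%E.
Proof.
have := @hitp_superharmonic _ _ branch_chain x B.
rewrite (@branch_sum x (fun y => hitp (y : state branch_chain) B))// => y.
exact: hitp_fin_num.
Qed.

Lemma hitp_branch_det x (B : set X) o : wt x o = 1 ->
  (hitp (succ x o : state branch_chain) B <= hitp (x : state branch_chain) B)%E.
Proof.
move=> o1; apply: le_trans (hitp_branch_superharmonic _ _).
rewrite -[leLHS]mul1e -[1%E]/(1%:E) -o1.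
apply: (@esum_ge_term _ _ _ (fun o => (wt x o)%:E * hitp _ _)%E) => // o' _.
by rewrite mule_ge0 ?hitp_ge0// lee_fin.
Qed.

Lemma hitp_branch1 x (B : set X) :
  (forall o, (0 < wt x o)%R -> 1 <= hitp (succ x o : state branch_chain) B)%E ->
  (1 <= hitp (x : state branch_chain) B)%E.
Proof.
move=> h; apply: le_trans (hitp_branch_superharmonic _ _).
rewrite -[leLHS](wt_sum1 x); apply: le_esum => o _.
have := wt_ge0 x o; rewrite le_eqVlt => /orP[/eqP<-|o0]; first by rewrite mul0e.
by rewrite -[leLHS]mule1 lee_wpmul2l ?h// lee_fin ltW.
Qed.

End branching_chain.

(** * Restriction of a chain to a closed set of states *)

Section restricted_chain.
Context (R : realType) (A : finType) (M : markov_chain R A).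
Context (V : pred (state M)).
Hypothesis V_init : V (init M).
Hypothesis V_closed : forall s t, V s -> 0 < trans s t -> V t.

Lemma restrict_sum (s : {s | V s}) (g : state M -> \bar R) :
  (\esum_(t in [set: {s | V s}]) ((trans (val s) (val t))%:E * g (val t)) =
   \esum_(t in [set: state M]) ((trans (val s) t)%:E * g t))%E.
Proof.
rewrite -(@esum_image _ _ _ setT (val : {s | V s} -> state M)
  (fun t => ((trans (val s) t)%:E * g t)%E)); last first.
  by move=> x y _ _; exact: val_inj.
rewrite [LHS]esum_mkcond; apply: eq_esum => t _; case: ifPn => //.
rewrite notin_setE => nt.
have := trans_ge0 (val s) t; rewrite le_eqVlt => /orP[/eqP<-|st].
  by rewrite mul0e.
by exfalso; apply: nt; exists (exist _ t (V_closed (valP s) st)).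
Qed.

Lemma restrict_sum1 (s : {s | V s}) :
  (\esum_(t in [set: {s | V s}]) (trans (val s) (val t))%:E = 1)%E.
Proof.
have := restrict_sum s (fun=> 1%E).
under eq_esum do rewrite mule1.
by under [X in _ = X -> _]eq_esum do rewrite mule1; rewrite trans_sum1.
Qed.

Definition restrict_chain : markov_chain R A :=
  MarkovChain (fun s t : {s | V s} => trans_ge0 (val s) (val t))
    (fun s t => trans_le1 (val s) (val t)) restrict_sum1
    (exist _ (init M) V_init) (fun s => label (val s)).

(** Negation occurs only at propositions, so truth is monotone in the truth of subformulas and one
    direction can be proved alone, by minimality of hitting probabilities in each of the two
    chains. *)
Lemma sat_restrict (phi : formula A) (s : state restrict_chain) :
  sat (val s) phi -> sat s phi.
Proof.
elim: phi s => // [f IHf g IHg|f IHf g IHg|c q f IH|c q f IH] s.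
- by move=> [/IHf ? /IHg].
- by move=> [/IHf|/IHg]; [left|right].
- apply: meets_bound_le.
  rewrite -[leLHS]/(hitp (val s) [set t | sat t f]).
  rewrite -[leRHS]/(@hitp _ _ restrict_chain s [set t | sat t f]).
  (* Outside [V] the value 1 is an upper bound for every hitting probability. *)
  pose g (x : state M) := if insub x is Some t
     then hitp (t : state restrict_chain) [set t | sat t f] else 1%E.
  have gE (t : {s | V s}) : g (val t) = hitp (t : state restrict_chain) [set t | sat t f].
    by rewrite /g valK.
  have g0 x : (0 <= g x)%E by rewrite /g; case: insub => // t; exact: hitp_ge0.
  have g1 x : (g x <= 1)%E by rewrite /g; case: insub => // t; exact: hitp_le1.
  rewrite -gE; apply: hitp_min => // x.
    rewrite /g; case: insubP => // t _ <- /IH h.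
    by rewrite hitp_in.
  move=> _; rewrite [g x]/g; case: insubP => [t _ <-|_].
    rewrite -restrict_sum; under eq_esum do rewrite gE.
    exact: (@hitp_superharmonic _ _ restrict_chain).
  rewrite -[leRHS](trans_sum1 x); apply: le_esum => u _.
  by rewrite -[leRHS]mule1 lee_wpmul2l// lee_fin trans_ge0.
apply: meets_bound_le.
rewrite (always_hitp _ [set t | sat t f]).
rewrite (@always_hitp _ _ restrict_chain _ [set t | sat t f]).
rewrite leeB//; apply: (hitp_min (g := fun t : state restrict_chain => hitp (val t) _)).
- by move=> t; exact: hitp_ge0.
- by move=> t nt; rewrite hitp_in// => /IH.
- move=> t _; rewrite [leLHS](restrict_sum t (fun t => hitp t _)).
  exact: hitp_superharmonic.
Qed.

End restricted_chain.


(** * Qualitative formulas along paths *)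

Local Notation F1 psi := (Finally AtLeast threshold1 psi).
Local Notation G1 psi := (Globally AtLeast threshold1 psi).

Section subformulas.
Context (A : finType).
Implicit Types (phi psi : formula A).

Fixpoint finally_bodies phi : seq (formula A) :=
  match phi with
  | Atom _ | NegAtom _ => [::]
  | And f g | Or f g => finally_bodies f ++ finally_bodies g
  | Finally _ _ f => f :: finally_bodies f
  | Globally _ _ f => finally_bodies f
  end.

Fixpoint globally_bodies phi : seq (formula A) :=
  match phi with
  | Atom _ | NegAtom _ => [::]
  | And f g | Or f g => globally_bodies f ++ globally_bodies g
  | Finally _ _ f => globally_bodies f
  | Globally _ _ f => f :: globally_bodies f
  end.

Fixpoint finally_bodies_under_globally phi : seq (formula A) :=
  match phi with
  | Atom _ | NegAtom _ => [::]
  | And f g | Or f g =>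
      finally_bodies_under_globally f ++ finally_bodies_under_globally g
  | Finally _ _ f => finally_bodies_under_globally f
  | Globally _ _ f => finally_bodies f
  end.

(** [Globally] contributes nothing: the F-subformulas below it are qualitative and are treated by
    fairness. *)
Fixpoint outermost_finally_bodies phi : seq (formula A) :=
  match phi with
  | And f g | Or f g =>
      outermost_finally_bodies f ++ outermost_finally_bodies g
  | Finally _ _ f => [:: f]
  | _ => [::]
  end.

Fixpoint finally_outside_globally phi : nat :=
  match phi with
  | And f g | Or f g =>
      finally_outside_globally f + finally_outside_globally g
  | Finally _ _ f => (finally_outside_globally f).+1
  | _ => 0
  end.

Lemma size_finally_bodies phi : (size (finally_bodies phi) < formula_length phi)%N.
Proof.
by elim: phi => [a|a|f IHf g IHg|f IHf g IHg|c q f IH|c q f IH] /=;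
  rewrite ?size_cat; lia.
Qed.

Lemma finally_count_lt phi :
  (finally_outside_globally phi + size (finally_bodies_under_globally phi) <
   formula_length phi)%N.
Proof.
elim: phi => [a|a|f IHf g IHg|f IHf g IHg|c q f IH|c q f IH] /=;
  rewrite ?size_cat; try lia.
by have := size_finally_bodies f; lia.
Qed.

(** A pending body can cause one discharge of its own and one for each F nested in it outside G; the
    total bounds the number of discharges still to come. *)
Definition pending_weight (P : seq (formula A)) : nat :=
  \sum_(f <- P) (finally_outside_globally f).+1.

Lemma pending_weight_outermost phi :
  pending_weight (outermost_finally_bodies phi) = finally_outside_globally phi.
Proof.
rewrite /pending_weight; elim: phi => [a|a|f IHf g IHg|f IHf g IHg|c q f _|c q f _] /=;
  by rewrite ?big_nil ?big_cat ?big_seq1 //= IHf IHg.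
Qed.

End subformulas.

Lemma count_ltn (T : eqType) (a b : pred T) s :
  {in s, forall x, a x -> b x} -> has (fun x => b x && ~~ a x) s ->
  (count a s < count b s)%N.
Proof.
elim: s => //= x s IH ab h.
have abs : {in s, forall y, a y -> b y} by move=> y ys; apply: ab; rewrite inE ys orbT.
have le : (count a s <= count b s)%N.
  elim: {IH ab h} s abs => //= y s IH abs; apply: leq_add.
    by have := abs y (mem_head _ _); case: (a y) => // ->.
  by apply: IH => z zs; apply: abs; rewrite inE zs orbT.
have := ab x (mem_head _ _); case/orP: h => [/andP[-> /negbTE->] _|/(IH abs)]; first by lia.
by case: (a x) => [lt ->//|]; lia.
Qed.

Section qualitative.
Context (R : realType) (A : finType) (M : markov_chain R A).
Implicit Types (x y z : state M) (l w : seq (state M)) (psi : formula A).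

Let edge : rel (state M) := fun x y => 0 < trans x y.

Lemma sat_F1 x psi : sat x (F1 psi) <-> (1 <= hitp x [set y | sat y psi])%E.
Proof. by rewrite /= rmorph1. Qed.

Lemma sat_G1 x psi :
  sat x (G1 psi) <-> (1 <= run_measure x [set pi | forall i, [set y | sat y psi] (pi i)])%E.
Proof. by rewrite /= rmorph1. Qed.

Lemma G1_now x psi : sat x (G1 psi) -> sat x psi.
Proof. by move=> /sat_G1/always1_in. Qed.

Lemma G1_step x y psi : edge x y -> sat x (G1 psi) -> sat y (G1 psi).
Proof. by move=> xy /sat_G1 h; apply/sat_G1; exact: always1_step xy. Qed.

Definition seen psi l := has (fun z => `[< sat z psi >]) l.

(** As long as [psi] has not been met, probability 1 of reaching it passes to every successor. *)
Lemma F1_path x w psi : path edge x w -> sat x (F1 psi) ->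
  seen psi (x :: w) \/ sat (last x w) (F1 psi).
Proof.
elim: w x => [|y w IH] x /=; first by right.
move=> /andP[xy yw] Fx; case: asboolP => [|nx]; first by left.
by apply: IH => //; apply/sat_F1/(hitp1_step _ nx xy)/sat_F1.
Qed.

Lemma F1_reach x psi : sat x (F1 psi) ->
  exists2 w, path edge x w & sat (last x w) psi.
Proof.
move=> /sat_F1 h.
by apply: (@hitp_gt0_path _ _ _ x [set y | sat y psi]); exact: lt_le_trans h.
Qed.

Variables Fs Gs : seq (formula A).

(** A shortened path jumps between states that need not be joined by an edge; this preorder is what
    survives of the edges. *)
Definition gmono : rel (state M) := fun x y =>
  `[< forall psi, psi \in Gs -> sat x (G1 psi) -> sat y (G1 psi) >].

Lemma gmono_refl : reflexive gmono.
Proof. by move=> x; apply/asboolP. Qed.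

Lemma gmono_trans : transitive gmono.
Proof.
by move=> y x z /asboolP xy /asboolP yz; apply/asboolP => psi G /(xy _ G)/(yz _ G).
Qed.

Lemma edge_gmono : subrel edge gmono.
Proof. by move=> x y xy; apply/asboolP => psi _; exact: G1_step. Qed.

Lemma path_gmono x w : path edge x w -> gmono x (last x w).
Proof.
elim: w x => [|y w IH] x /=; first by rewrite gmono_refl.
by move=> /andP[/edge_gmono xy /IH]; exact: gmono_trans.
Qed.

(* Every [F1 psi] true along [l] is witnessed later in [l], or handed over to
   whatever [Q] describes the continuation of [l]. *)
Fixpoint fair (Q : formula A -> Prop) l : Prop :=
  if l is y :: r then
    (forall psi, psi \in Fs -> sat y (F1 psi) -> seen psi l \/ Q psi) /\ fair Q r
  else True.

Lemma fair_cat Q l1 l2 : fair Q l1 -> fair Q l2 -> fair Q (l1 ++ l2).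
Proof.
elim: l1 => //= y r IH [h /IH{}IH] /IH; split=> // psi psiF /(h _ psiF)[s|]; [left|by right].
by move: s => /=; rewrite /seen has_cat => /orP[->|->] //; rewrite orbT.
Qed.

Lemma fair_sub Q Q' l : (forall psi, psi \in Fs -> Q psi -> Q' psi) ->
  fair Q l -> fair Q' l.
Proof.
move=> QQ'; elim: l => //= y r IH [h /IH]; split=> // psi psiF /(h _ psiF)[|/QQ'];
  by [left|right; auto].
Qed.

(* Keeps the last occurrence of each body of [Fs]. *)
Fixpoint keep l :=
  if l is y :: r then
    if has (fun psi => `[< sat y psi >] && ~~ seen psi r) Fs then y :: keep r
    else keep r
  else [::].

Lemma keep_subseq l : subseq (keep l) l.
Proof.
elim: l => //= y r IH; case: ifP => _; first by rewrite eqxx.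
exact: subseq_trans IH (subseq_cons _ _).
Qed.

Lemma keep_size l : (size (keep l) <= size Fs)%N.
Proof.
(* Strengthened for the induction: each kept state adds at least one body to those seen in the
   list. *)
suff : (size (keep l) <= count (seen^~ l) Fs)%N.
  by move/leq_trans; apply; exact: count_size.
elim: l => //= y r IH; case: ifPn => h /=; last first.
  by apply: leq_trans IH _; apply: sub_count => psi /= ->; rewrite orbT.
apply: leq_ltn_trans IH _; apply: count_ltn => [psi _ /= ->|]; first by rewrite orbT.
apply: sub_has h => psi /andP[/= -> //].
Qed.

Lemma keep_seen psi l : psi \in Fs -> seen psi l -> seen psi (keep l).
Proof.
move=> psiF; elim: l => //= y r IH; case: ifPn => [_ /=|/hasPn/(_ _ psiF) h].
  by case/orP => [->//|/IH ->]; rewrite orbT.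
by case/orP => [yp|/IH//]; move: h; rewrite yp /= negbK.
Qed.

Lemma keep_fair x w : path edge x w ->
  fair (fun psi => sat (last x w) (F1 psi)) (keep (x :: w)).
Proof.
elim: w x => [|y w IH] x xw; rewrite [keep _]/=; case: ifPn => // h.
- split=> //= psi psiF Fx; by right.
- move: (xw) => /= /andP[_ yw]; split; last exact: (IH y).
  move=> psi psiF /(F1_path xw)[s|]; [left|by right].
  by have := keep_seen psiF s; rewrite [keep _]/= h.
- by move: xw => /= /andP[_]; exact: IH.
Qed.

Lemma keep_sorted x w y : path gmono x w -> gmono (last x w) y ->
  path gmono x (rcons (keep (x :: w)) y).
Proof.
move=> xw wy.
(* Since [keep] may or may not retain [x], the subsequence is taken in a path that begins with a
   second copy of [x]. *)
have p : path gmono x (x :: rcons w y).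
  by rewrite /= gmono_refl rcons_path xw.
apply: (subseq_path gmono_trans _ p).
rewrite -cats1 -rcons_cons -cats1; apply: cat_subseq => //; exact: keep_subseq.
Qed.

(** The last state is appended because the pending bodies it satisfies need not be in [Fs]. The
    block is nonempty even for [w = [::]], so every discharge creates a node. *)
Definition block x w := rcons (keep (x :: w)) (last x w).

Lemma block_size x w : (size (block x w) <= (size Fs).+1)%N.
Proof. by rewrite size_rcons ltnS keep_size. Qed.

Lemma block_gmono x w : path edge x w -> path gmono x (block x w).
Proof.
by move=> /(sub_path edge_gmono) xw; apply: keep_sorted => //; exact: gmono_refl.
Qed.

Lemma block_fair x w : path edge x w ->
  fair (fun psi => sat (last x w) (F1 psi)) (x :: block x w).
Proof.
move=> xw; split.
  move=> psi psiF /(F1_path xw)[s|]; [left|by right].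
  have := keep_seen psiF s; rewrite /block -cats1 -cat_cons /seen has_cat /= => ->.
  by rewrite orbT.
rewrite /block -cats1; apply: fair_cat; first exact: keep_fair.
by split=> // psi _; right.
Qed.

(** [pre] leads from [x] to the cycle [c :: cs], which closes up by a jump from its last state to
    [c]; anything owed along the lasso is paid later on it or on the cycle. *)
Definition is_lasso x (L : seq (state M) * state M * seq (state M)) : Prop :=
  let: (pre, c, cs) := L in
  [/\ (size pre + size cs <= (size Fs).*2)%N, path gmono x (pre ++ c :: cs),
      gmono (last c cs) c &
      fair (fun psi => seen psi (c :: cs)) (x :: pre ++ c :: cs)].

Lemma lasso_ex x : exists L, is_lasso x L.
Proof.
(* The number of true G-formulas is bounded by [size Gs], hence attains a maximum over the states
   reachable from [x]. *)
pose nG y := count (fun psi => `[< sat y (G1 psi) >]) Gs.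
pose Pn n := `[< exists2 w, path edge x w & nG (last x w) = n >].
have exPn : exists n, Pn n by exists (nG x); apply/asboolP; exists [::].
have ubPn n : Pn n -> (n <= size Gs)%N by move=> /asboolP[w _ <-]; exact: count_size.
case: (ex_maxnP exPn ubPn) => _ /asboolP[w xw <-] wmax.
set t := last x w in wmax *.
(* By maximality at [t], all states reachable from [t] are equivalent for [gmono], so they can be
   visited in any order. *)
have eqG v : path edge t v -> gmono t (last t v) /\ gmono (last t v) t.
  move=> tv; have tu := path_gmono tv; split=> //.
  apply: contrapT => nut; have /asboolP h := tu.
  have : (nG t < nG (last t v))%N.
    apply: count_ltn => [psi psiG /asboolP/(h _ psiG)/asboolP//|].
    apply: contrapT => /negP/hasPn nh; apply: nut; apply/asboolP => psi psiG u.
    by have := nh psi psiG; rewrite (asboolT u) /= negbK => /asboolP.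
  rewrite ltnNge wmax//; apply/asboolP; exists (w ++ v); last by rewrite last_cat.
  by rewrite cat_path xw.
(* The bodies with a witness reachable from [t]; [pick] chooses one witness for each, and [cs] lists
   them. *)
pose rs psi := exists2 v, path edge t v & sat (last t v) psi.
pose pick psi := if pselect (rs psi) is left e
   then Some (last t (s2val (cid2 e))) else None.
have pickP psi y : pick psi = Some y ->
    exists v, [/\ path edge t v, last t v = y & sat y psi].
  rewrite /pick; case: pselect => // e [<-]; case: cid2 => v /= tv sv.
  by exists v.
pose cs := pmap pick Fs.
have csP y : y \in t :: cs -> exists2 v, path edge t v & last t v = y.
  rewrite inE => /orP[/eqP->|]; first by exists [::].
  by rewrite mem_pmap => /mapP[psi _ /esym/pickP[v [tv ly _]]]; exists v.
have seen_cs psi : psi \in Fs -> rs psi -> seen psi (t :: cs).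
  move=> psiF e; case E : (pick psi) => [y|]; last by move: E; rewrite /pick; case: pselect.
  have [v [_ _ sy]] := pickP _ _ E; apply/hasP; exists y; last exact/asboolP.
  by rewrite inE mem_pmap; apply/orP; right; apply/mapP; exists psi.
have tcs y : y \in t :: cs -> gmono t y /\ gmono y t.
  by move=> /csP[v /eqG + <-].
have cs_fair l : {subset l <= t :: cs} -> fair (fun psi => seen psi (t :: cs)) l.
  elim: l => // y r IH sub; split.
    move=> psi psiF /F1_reach[v yv sv]; right; apply: seen_cs => //.
    have [u tu uy] := csP y (sub _ (mem_head _ _)).
    by exists (u ++ v); [rewrite cat_path tu uy|rewrite last_cat uy].
  by apply: IH => z zr; apply: sub; rewrite inE zr orbT.
have cs_path l u : gmono u t -> {subset l <= t :: cs} -> path gmono u l.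
  elim: l u => // y r IH u ut sub /=.
  have [ty yt] := tcs y (sub _ (mem_head _ _)).
  rewrite (gmono_trans ut ty) IH// => z zr.
  by apply: sub; rewrite inE zr orbT.
exists (keep (x :: w), t, cs); split.
- rewrite -addnn leq_add ?keep_size// /cs size_pmap.
  exact: count_size.
- rewrite -cat_rcons cat_path last_rcons; apply/andP; split.
    by apply: keep_sorted; [exact: (sub_path edge_gmono)|exact: gmono_refl].
  apply: cs_path => [|z zc]; first exact: gmono_refl.
  by rewrite inE zc orbT.
- by have [] := tcs (last t cs) (mem_last _ _).
have F1t psi : psi \in Fs -> sat t (F1 psi) -> seen psi (t :: cs).
  by move=> psiF /F1_reach[v tv sv]; apply: seen_cs => //; exists v.
split.
  move=> psi psiF /(F1_path xw)[s|/(F1t _ psiF)]; [left|by right].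
  have := keep_seen psiF s; rewrite /seen /= has_cat => ->.
  by rewrite orbT.
by apply: fair_cat (cs_fair _ _) => //; apply: fair_sub (keep_fair xw).
Qed.

Definition lasso x := sval (cid (lasso_ex x)).

Lemma lassoP x : is_lasso x (lasso x).
Proof. by rewrite /lasso; case: cid. Qed.

Definition pending_set (P : seq (formula A)) : set (state M) :=
  [set y | exists2 f, f \in P & sat y f].

Definition discharge y (P : seq (formula A)) : seq (formula A) :=
  flatten [seq if `[< sat y f >] then outermost_finally_bodies f else [:: f] | f <- P].

(** A satisfied body is replaced by bodies weighing exactly one less in total; the others stay. *)
Lemma discharge_weight y P : pending_set P y ->
  (pending_weight (discharge y P) < pending_weight P)%N.
Proof.
have le (Q : seq (formula A)) : (pending_weight (discharge y Q) <= pending_weight Q)%N.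
  rewrite /pending_weight; elim: Q => [|f Q IH]; first by rewrite big_nil.
  rewrite /discharge /= big_cat big_cons /= leq_add//.
  by case: asboolP => _; rewrite ?big_seq1// -/(pending_weight _) pending_weight_outermost.
case=> f; elim: P => // g P IH; rewrite inE => fP sf.
rewrite /pending_weight /discharge /= big_cat big_cons /= -/(discharge y P).
have := le P; rewrite /pending_weight => leP.
case/orP: fP => [/eqP<-|/IH /(_ sf)].
  rewrite asboolT// -/(pending_weight _) pending_weight_outermost; lia.
rewrite /pending_weight => lt.
suff : (pending_weight (if `[< sat y g >] then outermost_finally_bodies g else [:: g]) <=
  (finally_outside_globally g).+1)%N by rewrite /pending_weight; lia.
by case: ifP => _; rewrite ?pending_weight_outermost// /pending_weight big_seq1.
Qed.

Lemma discharge_keep y P f : f \in P -> ~ sat y f -> f \in discharge y P.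
Proof.
move=> fP nf; apply/flattenP; exists [:: f]; last by rewrite inE.
by apply/mapP; exists f => //; rewrite asboolF.
Qed.

Lemma discharge_open y P f : f \in P -> sat y f ->
  {subset outermost_finally_bodies f <= discharge y P}.
Proof.
move=> fP sf g gf; apply/flattenP; exists (outermost_finally_bodies f) => //.
by apply/mapP; exists f => //; rewrite asboolT.
Qed.

End qualitative.


(** * The unfolded chain *)

Section unfolding.
Context (R : realType) (A : finType) (M : markov_chain R A).
Variables (phi : formula A).

Let Fs := finally_bodies_under_globally phi.
Let Gs := globally_bodies phi.

(* A history lists the visited nodes, the current one first. A node
   [(x, P, r, m)] stands at [x] and has to walk through [r]; after that, it
   branches over the first hits of [pending_set P] if [m = None], and jumps
   [k] nodes back if [m = Some k]. *)
Definition node : countType :=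
  (state M * seq (formula A) * seq (state M) * option nat)%type.
Definition history : countType := seq node.

Definition current (h : history) : state M :=
  if h is (x, _, _, _) :: _ then x else init M.

Definition enter (l : seq (state M)) P m (h : history) : history :=
  if l is y :: r then (y, P, r, m) :: h else h.

(** Only a branching node depends on the outcome: [Some w] stands for the first-hit word [w],
    replaced by its block, and [None] for never hitting. Jumping back [size cs] nodes from the end
    of a lasso lands on [c]. *)
Definition succ (h : history) (o : option (seq (state M))) : history :=
  match h with
  | (_, P, y :: r, m) :: _ => (y, P, r, m) :: h
  | (_, _, [::], Some k) :: _ => drop k h
  | (x, P, [::], None) :: _ =>
      if o is Some w
      then enter (block Fs x w) (discharge (last x w) P) None h
      else let: (pre, c, cs) := lasso Fs Gs x in
           enter (pre ++ c :: cs) P (Some (size cs)) h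
  | [::] => [::]
  end.

Definition wt (h : history) (o : option (seq (state M))) : R :=
  match h with
  | (x, P, [::], None) :: _ =>
      if o is Some w
      then if `[< first_hit (pending_set P) x w >] then path_prob x w else 0
      else 1 - fine (hitp x (pending_set P))
  | _ => if o is None then 1 else 0
  end.

Lemma wt_ge0 h o : 0 <= wt h o.
Proof.
case: h => [|[[[x P] [|y r]] [k|]] h] /=; case: o => [w|] //.
  by case: ifP => // _; exact: path_prob_ge0.
by rewrite subr_ge0 -lee_fin fineK ?hitp_le1// hitp_fin_num.
Qed.

Lemma wt_sum1 h : (\esum_(o in [set: option (seq (state M))]) (wt h o)%:E = 1)%E.
Proof.
rewrite esum_option; last by move=> o; rewrite lee_fin wt_ge0.
case: h => [|[[[x P] [|y r]] [k|]] h] /=;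
  try by rewrite esum1 ?adde0.
rewrite [X in (_ + X)%E](_ : _ = hitp x (pending_set P)); last first.
  rewrite hitpE /hitsum esum_mkcond; apply: eq_esum => w _.
  case: asboolP => fw; first by rewrite mem_set ?mule1.
  by rewrite memNset.
by rewrite EFinB fineK ?subeK// hitp_fin_num.
Qed.

Definition root_node : node :=
  (init M, outermost_finally_bodies phi, [::], None).

Definition unfolded : markov_chain R A :=
  branch_chain succ [:: root_node] (fun h => label (current h)) wt_ge0 wt_sum1.

(** Every suffix of a valid history longer than the root arises from its tail by a step of positive
    weight; these histories become the tree nodes. *)
Fixpoint valid (h : history) : Prop :=
  if h is c :: h1 then
    h1 = [::] /\ c = root_node \/
    valid h1 /\ exists2 o, succ h1 o = h & 0 < wt h1 o
  else False.

Fixpoint push P m l (h : history) : history :=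
  if l is y :: r then push P m r ((y, P, r, m) :: h) else h.

Lemma push_cat P m pre c cs h :
  exists h1, push P m (pre ++ c :: cs) h = push P m cs ((c, P, cs, m) :: h1).
Proof. by elim: pre h => [|y r IH] h /=; [exists h|exact: IH]. Qed.

Lemma drop_push P m l h : drop (size l) (push P m l h) = h.
Proof.
elim: l h => [|y r IH] h /=; first by rewrite drop0.
by rewrite -add1n -drop_drop IH /= drop0.
Qed.

Lemma push_head P m x r h :
  exists h1, push P m r ((x, P, r, m) :: h) = (last x r, P, [::], m) :: h1.
Proof. by elim: r x h => [|y r IH] x h /=; [exists h|exact: IH]. Qed.

Let a := finally_outside_globally phi.
Let b := size Fs.

(** Each unit of pending weight pays for one block of at most [b.+1] nodes, and the lasso adds at
    most [b.*2.+1]; the last [.+1] counts the root. On a lasso, the existential clause identifies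
    the jump target as the start [c] of the cycle. *)
Definition node_invariant (h : history) : Prop :=
  match h with
  | (x, P, r, None) :: _ =>
      [/\ path (gmono Gs) x r,
          (size h + size r + pending_weight P * b.+1 <= (a * b.+1).+1)%N &
          fair Fs (fun psi => sat (last x r) (F1 psi)) (x :: r)]
  | (x, P, r, Some k) :: _ =>
      [/\ path (gmono Gs) x r,
          (size h + size r <= (a * b.+1 + b.*2.+1).+1)%N &
          exists c cs h1,
            [/\ drop k (push P (Some k) r h) = (c, P, cs, Some k) :: h1,
                gmono Gs (last x r) c &
                fair Fs (fun psi => seen psi (c :: cs)) (x :: r)]]
  | [::] => True
  end.

Lemma wt_branch_word x P h w : 0 < wt ((x, P, [::], None) :: h) (Some w) ->
  first_hit (pending_set P) x w /\ 0 < path_prob x w.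
Proof. by rewrite /=; case: asboolP => //; rewrite ltxx. Qed.

Lemma valid_invariant h : valid h -> node_invariant h.
Proof.
elim: h => // c h1 IH [[-> ->]|[vh1 [ o so wo]]].
  split=> //=; last by split=> // psi _; right.
  by rewrite pending_weight_outermost; lia.
have {}IH := IH vh1.
case: h1 IH vh1 so wo => [|[[[x P] [|y r]] [k|]] h] // + _.
(* A jump back never lengthens the history, so it cannot have produced [c :: h1]. *)
- move=> _ /(congr1 size); rewrite size_drop /=; lia.
- move=> [_ Hs _]; case: o => [w|].
    move=> so /wt_branch_word[fw /path_prob_path xw]; rewrite /= in so.
    have := block_gmono Fs Gs xw; have := block_fair Fs xw; have := block_size Fs x w.
    have lw : last x (block Fs x w) = last x w by rewrite /block last_rcons.
    move: so lw; case: (block Fs x w) => [|y r] /=.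
      by move=> /(congr1 size) /=; lia.
    case=> <- lw bs [_ bf] /andP[_ bg]; split=> //; last by rewrite lw.
    (* The weight drops by at least one, which frees the [b.+1] nodes taken by the block. *)
    have := discharge_weight (first_hit_last fw).
    rewrite /= in Hs bs *; rewrite -/b in bs; nia.
  move=> /= + _; have := lassoP Fs Gs x; case: (lasso Fs Gs x) => [[pre c'] cs].
  case=> Ls Lg Lc Lf.
  have [h1 e1] := push_cat P (Some (size cs)) pre c' cs ((x, P, [::], None) :: h).
  have ll : last x (pre ++ c' :: cs) = last c' cs by rewrite last_cat.
  have sl : size (pre ++ c' :: cs) = (size pre + size cs).+1.
    by rewrite size_cat /= addnS.
  move: e1 ll sl Lg Lf; case: (pre ++ c' :: cs) => [|y r] //= e1 ll sl.
  move=> /andP[_ yr] [_ Lf] [<-]; split=> //.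
    rewrite /= in Hs *; rewrite -/b in Ls; nia.
  exists c', cs, h1; split=> //; last by rewrite ll.
  by rewrite e1 drop_push.
- move=> [/andP[_ yr] Hs [c' [cs [h1 [e g [_ f]]]]]] [<-] _.
  split=> //; first by rewrite /= in Hs *; lia.
  by exists c', cs, h1.
- move=> [/andP[_ yr] Hs [_ f]] [<-] _.
  by split=> //; rewrite /= in Hs *; lia.
Qed.

Lemma valid_drop k h : valid h -> (k < size h)%N -> valid (drop k h).
Proof.
elim: k h => [|k IH] [|c h] //= [[-> _]//|[vh _]]; exact: IH.
Qed.

Lemma enter_neq0 l P m h : l != [::] ->
  exists y r, l = y :: r /\ enter l P m h = (y, P, r, m) :: h.
Proof. by case: l => // y r _; exists y, r. Qed.

Lemma valid_succ h o : valid h -> 0 < wt h o ->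
  valid (succ h o) /\ gmono Gs (current h) (current (succ h o)).
Proof.
move=> vh wo; have inv := valid_invariant vh.
have cons_valid c : succ h o = c :: h -> valid (succ h o).
  by move=> e; rewrite e; right; split=> //; exists o.
case: h vh wo inv cons_valid => [|[[[x P] [|y r]] m] h] //; last first.
  by case: m => [k|] vh wo [/= /andP[g _] _ _] /(_ _ erefl) v; split.
case: m => [k|] vh wo [_ _].
  case=> c [cs [h1 [/= e g _]]] _; split; last by rewrite e.
  apply: valid_drop => //; rewrite ltnNge; apply/negP => ks.
  by move: e; rewrite drop_oversize.
move=> _; case: o wo => [w /wt_branch_word[fw /path_prob_path xw]|_].
  rewrite [succ _ _]/=; have [|y [r [e ->]]] := @enter_neq0 (block Fs x w) (discharge (last x w) P)
      None ((x, P, [::], None) :: h).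
    by rewrite /block; case: keep.
  move=> /(_ _ erefl) v; split=> //.
  by have := block_gmono Fs Gs xw; rewrite e /= => /andP[].
rewrite [succ _ _]/=.
have := lassoP Fs Gs x; case: (lasso Fs Gs x) => [[pre c'] cs] [_ + _ _].
have [|y [r [e ->]]] := @enter_neq0 (pre ++ c' :: cs) P (Some (size cs))
    ((x, P, [::], None) :: h).
  by case: (pre).
by rewrite e => /= /andP[g _] /(_ _ erefl) v; split.
Qed.

Lemma valid_trans (h h' : state unfolded) : valid h -> 0 < trans h h' ->
  valid h' /\ gmono Gs (current h) (current h').
Proof.
by move=> vh /(branch_trans_gt0 wt_ge0 wt_sum1)[ o <- wo]; exact: valid_succ.
Qed.

(** * Hitting probabilities in the unfolded chain and transfer of truth *)

Local Notation hitX h B := (@hitp _ _ unfolded (h : history) B).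

Lemma hit_det h (B : set history) : wt h None = 1 ->
  (hitX (succ h None) B <= hitX h B)%E.
Proof. exact: hitp_branch_det. Qed.

Lemma hit_walk P m x r h (B : set history) :
  (hitX (push P m r ((x, P, r, m) :: h)) B <= hitX ((x, P, r, m) :: h) B)%E.
Proof.
elim: r x h => [|y r IH] x h //=; apply: le_trans (IH _ _) _.
exact: (@hit_det ((x, P, y :: r, m) :: h)).
Qed.

Lemma hit_seen P m x r h psi : seen psi (x :: r) ->
  (1 <= hitX ((x, P, r, m) :: h) [set h | sat (current h) psi])%E.
Proof.
elim: r x h => [|y r IH] x h.
  by rewrite /= orbF => /asboolP sx; rewrite hitp_in.
rewrite [seen _ _]/=; case: asboolP => [sx _|_ /IH{}IH]; first by rewrite hitp_in.
apply: le_trans (IH ((x, P, y :: r, m) :: h)) _.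
exact: (@hit_det ((x, P, y :: r, m) :: h)).
Qed.

Lemma hit_enter_seen l P m h psi : seen psi l ->
  (1 <= hitX (enter l P m h) [set h | sat (current h) psi])%E.
Proof. by case: l => // y r; exact: hit_seen. Qed.

Lemma hit_block P x w h (B : set history) :
  exists h1, (hitX ((last x w, P, [::], None) :: h1) B <=
              hitX (enter (block Fs x w) P None h) B)%E.
Proof.
have lw : last x (block Fs x w) = last x w by rewrite /block last_rcons.
have [|y [r [e ->]]] := @enter_neq0 (block Fs x w) P None h.
  by rewrite /block; case: keep.
have [h1 e1] := push_head P None y r h.
by exists h1; move: lw; rewrite e /= => <-; rewrite -e1; exact: hit_walk.
Qed.

(** Induction on the pending weight: a block either contains a witness or hands [F1 psi] to its last
    state, where the weight is smaller, and the lasso always contains a witness. *)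
Lemma hit_F1_branching psi P x h : psi \in Fs -> sat x (F1 psi) ->
  (1 <= hitX ((x, P, [::], None) :: h) [set h | sat (current h) psi])%E.
Proof.
move=> psiF; have [n] := ubnP (pending_weight P).
elim: n P x h => // n IH P x h Pn Fx.
case: (pselect (sat x psi)) => [sx|nx]; first by rewrite hitp_in.
apply: (@hitp_branch1 _ _ _ _ succ wt _ _ wt_ge0 wt_sum1) => -[w|] wo.
  have [fw /path_prob_path xw] := wt_branch_word wo.
  have [/(_ _ psiF Fx) + _] := block_fair Fs xw.
  rewrite [seen _ _]/= asboolF//= => -[s|Fl]; first exact: hit_enter_seen.
  have [h1] := hit_block (discharge (last x w) P) x w ((x, P, [::], None) :: h)
     [set h | sat (current h) psi].
  apply: le_trans; apply: IH => //.
  by have := discharge_weight (first_hit_last fw); lia.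
have := lassoP Fs Gs x; rewrite /succ; case: (lasso Fs Gs x) => [[pre c] cs].
case=> _ _ _ [/(_ _ psiF Fx) + _]; rewrite [seen _ _]/= asboolF//= => h1.
apply: hit_enter_seen; case: h1 => // s; rewrite /seen has_cat; apply/orP; by right.
Qed.

Lemma hit_F1 psi h : valid h -> psi \in Fs -> sat (current h) (F1 psi) ->
  (1 <= hitX h [set h | sat (current h) psi])%E.
Proof.
move=> vh psiF; have := valid_invariant vh.
case: h vh => // -[[[x P] r] [k|]] h _.
  case=> _ _ [c [cs [h1 [e _ [/(_ _ psiF) F _]]]]] /F[|s]; first exact: hit_seen.
  (* The witness lies on the cycle: walk to the end of the lasso, jump back to [c], and meet it from
     there. *)
  apply: le_trans (hit_walk _ _ _ _ _ _).
  have [h2 e2] := push_head P (Some k) x r h; rewrite e2 in e *.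
  apply: le_trans (hit_det _ _) => //; rewrite [succ _ _]e; exact: hit_seen.
case=> _ _ [/(_ _ psiF) F _] /F[|s]; first exact: hit_seen.
apply: le_trans (hit_walk _ _ _ _ _ _).
by have [h2 ->] := push_head P None x r h; exact: hit_F1_branching.
Qed.

Lemma hit_valid (h : history) (B : set history) : valid h ->
  (hitX h B <= hitX h (B `&` valid))%E.
Proof.
by apply: hitp_invariant => s t vs /(valid_trans vs)[].
Qed.

(** For F the witness is found almost surely by [hit_F1]. For G, the valid histories whose current
    state satisfies [G1 f] are closed under transitions, because every move, jumps included,
    respects [gmono]. *)
Lemma qualitative_truth psi : F1_G1_or psi ->
  {subset finally_bodies psi <= Fs} -> {subset globally_bodies psi <= Gs} ->
  forall h : state unfolded, valid h -> sat (current h) psi -> sat h psi.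
Proof.
elim=> {psi} // [f g _ IHf _ IHg|f g _ IHf _ IHg|f _ IH|f _ IH] sF sG h vh.
- move=> [? ?]; split; [apply: IHf|apply: IHg] => // ? fb; try (apply: sF);
    try (apply: sG); by rewrite /= mem_cat fb ?orbT.
- move=> [?|?]; [left; apply: IHf|right; apply: IHg] => // ? fb; try (apply: sF);
    try (apply: sG); by rewrite /= mem_cat fb ?orbT.
- move=> Fh; apply/sat_F1.
  have fF : f \in Fs by apply: sF; rewrite /= mem_head.
  apply: le_trans (hit_F1 vh fF Fh) _; apply: le_trans (hit_valid _ vh) _.
  apply: le_hitp => h' [sh' vh']; apply: IH => // g gf.
  by apply: sF; rewrite /= inE gf orbT.
move=> Gh; apply/sat_G1.
have fG : f \in Gs by apply: sG; rewrite /= mem_head.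
apply: (@always1_invariant _ _ unfolded
   [set h | valid h /\ sat (current h) (G1 f)]) => //.
  move=> h1 h2 [v1 G1h] /(valid_trans v1)[v2 /asboolP g12]; split=> //.
  exact: g12.
move=> h1 [v1 /G1_now s1]; apply: IH => // g gf.
by apply: sG; rewrite /= inE gf orbT.
Qed.

(** Quantitative truth is transferred only to nodes with no walk left and with the outermost
    F-bodies of [f] pending. *)
Definition branching_at (f : formula A) : set history :=
  [set h | exists x P h1, [/\ h = (x, P, [::], None) :: h1, sat x f &
                              {subset outermost_finally_bodies f <= P}]].

(** The strong Markov property splits at the first hit of the pending set. If [f] holds there, its
    F-bodies become pending and the end of the block is a target; otherwise [f] stays pending with
    smaller weight. *)
Lemma hit_pending f P x h : f \in P ->
  (hitp x [set y | sat y f] <= hitX ((x, P, [::], None) :: h) (branching_at f))%E.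
Proof.
have [n] := ubnP (pending_weight P); elim: n P x h => // n IH P x h Pn fP.
apply: le_trans (@strong_markov _ _ _ (pending_set P) _ _ _) _.
  by move=> y sy; exists f.
apply: le_trans (@hitp_branch_superharmonic _ _ _ _ succ wt _ _ wt_ge0 wt_sum1 _ _).
rewrite esum_option; last by move=> o; rewrite mule_ge0 ?hitp_ge0// lee_fin wt_ge0.
(* The outcome [None], which goes to the lasso, is bounded below by 0. *)
rewrite -[leLHS]add0e; apply: leeD; first by rewrite mule_ge0 ?hitp_ge0// lee_fin wt_ge0.
rewrite /hitsum esum_mkcond; apply: le_esum => w _.
case: ifPn => [|_]; last by rewrite mule_ge0 ?hitp_ge0// lee_fin wt_ge0.
rewrite inE => fw; rewrite [wt _ _]/= asboolT//.
apply: lee_wpmul2l; first by rewrite lee_fin path_prob_ge0.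
have [h1] := hit_block (discharge (last x w) P) x w ((x, P, [::], None) :: h)
   (branching_at f).
apply: le_trans; case: (pselect (sat (last x w) f)) => sl.
  rewrite [leRHS]hitp_in; first exact: hitp_le1.
  by exists (last x w), (discharge (last x w) P), h1; split=> //; exact: discharge_open.
apply: IH; last exact: discharge_keep.
by have := discharge_weight (first_hit_last fw); lia.
Qed.

Lemma quantitative_truth f : Fq1_G1_or f ->
  {subset finally_bodies_under_globally f <= Fs} ->
  {subset globally_bodies f <= Gs} ->
  forall x P h1, let h : state unfolded := (x, P, [::], None) :: h1 in
  valid h -> {subset outermost_finally_bodies f <= P} -> sat x f -> sat h f.
Proof.
elim=> {f} // [f g _ IHf _ IHg|f g _ IHf _ IHg|c q f _ IH|f Ff] sF sG x P h1 h vh sP.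
- move=> [? ?]; split; [apply: IHf|apply: IHg] => // ? fb; try (apply: sF);
    try (apply: sG); try (apply: sP); by rewrite /= mem_cat fb ?orbT.
- move=> [?|?]; [left; apply: IHf|right; apply: IHg] => // ? fb; try (apply: sF);
    try (apply: sG); try (apply: sP); by rewrite /= mem_cat fb ?orbT.
- apply: meets_bound_le.
  have fP : f \in P by apply: sP; rewrite /= mem_head.
  apply: le_trans (hit_pending x h1 fP) _; apply: le_trans (hit_valid _ vh) _.
  rewrite -[leRHS]/(@hitp _ _ unfolded h [set t | sat t f]).
  apply: le_hitp => _ [[y [Q [h2 [-> sy fQ]]]] v2]; exact: IH.
by move=> Gx; refine (qualitative_truth (F1_G1_or_globally Ff) sF sG vh Gx).
Qed.

Lemma valid_size h : valid h -> (size h <= (a * b.+1 + b.*2.+1).+1)%N.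
Proof.
move=> /valid_invariant; case: h => // -[[[x P] r] [k|]] h [_ /= hs _]; first by lia.
by move: (pending_weight P * b.+1)%N hs => p; lia.
Qed.

End unfolding.


(** * The tree model *)

Section tree_model.
Context (R : realType) (A : finType) (M : markov_chain R A) (phi : formula A).

(** Arbitrary lists of nodes are states of [unfolded]; only the valid ones form a tree. *)
Definition validb : pred (state (unfolded M phi)) := fun h => `[< valid phi h >].

Lemma validb_init : validb (init (unfolded M phi)).
Proof. by apply/asboolP; left. Qed.

Lemma validb_closed (h h' : state (unfolded M phi)) :
  validb h -> 0 < trans h h' -> validb h'.
Proof. by move=> /asboolP vh /(valid_trans vh)[? _]; apply/asboolP. Qed.

Definition tree_model : markov_chain R A := restrict_chain validb_init validb_closed.

Lemma tree_model_sat :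
  Fq1_G1_or phi -> is_model M phi -> is_model tree_model phi.
Proof.
move=> frag Mphi; apply: sat_restrict.
by apply: (quantitative_truth frag) => //; left.
Qed.

Definition tree_edge : rel (state tree_model) := fun s t => behead (val t) == val s.

Lemma tree_model_valid (s : state tree_model) : valid phi (val s).
Proof. by apply/asboolP; exact: (valP s). Qed.

Lemma tree_edge_trans (s t : state tree_model) : tree_edge s t -> 0 < trans s t.
Proof.
move=> /eqP; have := tree_model_valid t; have := tree_model_valid s.
rewrite -[trans s t]/(branch_trans (succ phi) (@wt R A M) (val s) (val t)).
case: (val t) => [//|c h] vs [[-> _]|[_ [ o so wo]]] e.
  by rewrite -e in vs.
rewrite -e [behead _]/= -so; apply: branch_trans_succ wo; [exact: wt_ge0|exact: wt_sum1].
Qed.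

Lemma tree_edge_parent (t : state tree_model) c d h : val t = c :: d :: h ->
  exists2 s : state tree_model, val s = d :: h & tree_edge s t.
Proof.
move=> e; have := tree_model_valid t; rewrite e => -[[]//|[vd _]].
have vb : validb (d :: h) by apply/asboolP.
by exists (exist _ (d :: h) vb) => //; rewrite /tree_edge e.
Qed.

Lemma tree_path_ex (s : state tree_model) :
  exists2 p, path tree_edge (init tree_model) p & last (init tree_model) p = s.
Proof.
have [n] := ubnP (size (val s)); elim: n s => // n IH s sn.
case e : (val s) => [|c [|d h]]; first by have := tree_model_valid s; rewrite e.
  exists [::] => //; apply: val_inj; rewrite e /=.
  by have := tree_model_valid s; rewrite e => -[[_ ->]//|[]].
have [s1 e1 es] := tree_edge_parent e.
have [|p pp lp] := IH s1; first by move: sn; rewrite e e1 /=; lia.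
by exists (rcons p s); rewrite ?last_rcons// rcons_path pp lp.
Qed.

Lemma tree_path_uniq p q :
  path tree_edge (init tree_model) p -> path tree_edge (init tree_model) q ->
  last (init tree_model) p = last (init tree_model) q -> p = q.
Proof.
(* The tail of the root is the empty history, which is not valid. *)
have no_root p' : ~ tree_edge p' (init tree_model).
  by move=> /eqP e; have := tree_model_valid p'; rewrite -e.
elim/last_ind: p q => [|p s IH] q; case/lastP: q => [|q t] //.
- by rewrite rcons_path last_rcons => _ /andP[_ + e]; rewrite -e => /no_root.
- by rewrite rcons_path last_rcons => /andP[_ + _ e]; rewrite e => /no_root.
rewrite !rcons_path !last_rcons => /andP[pp /eqP es] /andP[qq /eqP et] st.
by rewrite st (IH q)//; apply: val_inj; rewrite -es -et st.
Qed.

Lemma tree_path_size p : path tree_edge (init tree_model) p ->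
  size (val (last (init tree_model) p)) = (size p).+1.
Proof.
elim/last_ind: p => // p s IH; rewrite rcons_path last_rcons size_rcons.
move=> /andP[/IH{}IH /eqP e]; move: (IH); rewrite -e.
by have := tree_model_valid s; case: (val s) => //= c h _ ->.
Qed.

(** The two cases become tree edges and back edges. *)
Lemma succ_cons_or_drop (h : history M) o :
  (exists c, succ phi h o = c :: h) \/ (exists k, succ phi h o = drop k h).
Proof.
have enterP l P m h' : (exists c, @enter R A M l P m h' = c :: h') \/
    (exists k, enter l P m h' = drop k h').
  by case: l => [|y r]; [right; exists 0%N; rewrite drop0|left; exists (y, P, r, m)].
case: h => [|[[[x P] [|y r]] [k|]] h]; first by right; exists 0%N.
- by right; exists k.
- by case: o => [w|] /=; [|case: lasso => [[pre c] cs]]; exact: enterP.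
- by left; eexists.
- by left; eexists.
Qed.

Lemma tree_ancestor_drop k (s t : state tree_model) :
  val t = drop k (val s) -> tree_ancestor tree_edge t s.
Proof.
elim: k s => [|k IH] s; first by rewrite drop0 => /val_inj->; exists [::].
have := tree_model_valid t; case e : (val s) => [|c [|d h]] /= vt et.
- by rewrite et in vt.
- by rewrite et in vt.
have [s1 e1 es] := tree_edge_parent e.
have [|p pp lp] := IH s1; first by rewrite e1.
by exists (rcons p s); rewrite ?last_rcons// rcons_path pp lp.
Qed.

Lemma tree_model_height :
  exists2 h, (h <= formula_length phi ^ 2)%N & has_height tree_model h.
Proof.
pose Pn n := `[< exists2 p, path tree_edge (init tree_model) p & size p = n >].
have exPn : exists n, Pn n by exists 0%N; apply/asboolP; exists [::].
have ubPn n : Pn n -> (n <= formula_length phi ^ 2)%N.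
  move=> /asboolP[p /tree_path_size ps <-].
  (* With [a + b < l], the bound [a * (b + 1) + 2 * b + 1] is at most [(a + b + 1) ^ 2], hence at
     most [l ^ 2]. *)
  have := valid_size (tree_model_valid (last (init tree_model) p)); rewrite ps.
  have := finally_count_lt phi.
  move: (finally_outside_globally _) (size (finally_bodies_under_globally _)) => a b.
  by move: (formula_length _) (size p) => l m ? ?; rewrite expnS expn1; nia.
(* [tree_height] asks for a length that is attained, so the maximum is taken rather than the
   bound. *)
case: (ex_maxnP exPn ubPn) => n /asboolP[p pp pn] nmax.
exists n; first by apply: ubPn; apply/asboolP; exists p.
exists tree_edge; split.
- move=> s; have [q qq qs] := tree_path_ex s; exists q; split=> // q' [qq' qs'].
  by apply: tree_path_uniq; rewrite ?qs.
- split; last by exists p.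
  by move=> q qq; apply: nmax; apply/asboolP; exists q.
- exact: tree_edge_trans.
move=> s t.
rewrite -[trans s t]/(branch_trans (succ phi) (@wt R A M) (val s) (val t)).
move=> /(branch_trans_gt0 (@wt_ge0 R A M) (@wt_sum1 R A M))[ o so _].
case: (succ_cons_or_drop (val s) o) => [[c]|[k]]; rewrite so => e.
  by left; rewrite /tree_edge e.
by right; exact: tree_ancestor_drop e.
Qed.

End tree_model.

Theorem theorem6 (R : realType) (A : finType) (phi : formula A)
    (phi_frag : Fq1_G1_or phi) (phi_sat : satisfiable R phi) :
  exists M : markov_chain R A,
    is_model M phi /\
    exists2 h : nat, (h <= formula_length phi ^ 2)%N & has_height M h.
Proof.
have [M Mphi] := phi_sat; exists (tree_model M phi).
by split; [exact: tree_model_sat|exact: tree_model_height].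
Qed.
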